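(* Let $n$ be a positive integer, let $\gamma: S^n\to \mathbb{R}_+$ be a stable convex integrand and let $\delta: S^n\to \mathbb{R}_+$ be the dual convex integrand of $\gamma$. Moreover, let $\theta_0$ be a point of $S^n$ and let $i$ be an integer such that $0\le i\le n$. Then the following are equivalent. (1) The point $\theta_0\in S^n$ is a non-degenerate critical point of $\gamma$ with Morse index $i$. (2) The point $-\theta_0\in S^n$ is a non-degenerate critical point of $\delta$ with Morse index $n-i$. (3) The point $-\theta_0\in S^n$ is a non-degenerate critical point of $\widehat{\gamma}$ with Morse index $n-i$. (4) The point $\theta_0\in S^n$ is a non-degenerate critical point of $\widehat{\delta}$ with Morse index $i$.
   Context: $\mathbb{R}_+$ is the set of positive real numbers; $S^n$ is the unit sphere of $\mathbb{R}^{n+1}$. A point of $\mathbb{R}^{n+1}-\{\mathbf 0\}$ is written in polar form $(\theta,r)$ with $\theta\in S^n$, $r>0$ (i.e. the point $r\theta$). The inversion $\mathrm{inv}:\mathbb{R}^{n+1}-\{\mathbf 0\}\to\mathbb{R}^{n+1}-\{\mathbf 0\}$ is $\mathrm{inv}(\theta,r)=(-\theta,1/r)$. For a continuous function $\gamma:S^n\to\mathbb{R}_+$, $\mathrm{graph}(\gamma)=\{(\theta,\gamma(\theta)) \mid \theta\in S^n\}\subset\mathbb{R}^{n+1}-\{\mathbf 0\}$ (polar form), and $\Gamma_\gamma$ is the boundary of the convex hull of $\mathrm{inv}(\mathrm{graph}(\gamma))$. A continuous function $\gamma:S^n\to\mathbb{R}_+$ is a convex integrand if $\Gamma_\gamma=\mathrm{inv}(\mathrm{graph}(\gamma))$.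 The Wulff shape associated with $\gamma$ is $\mathcal{W}_\gamma=\bigcap_{\theta\in S^n}\{x\in\mathbb{R}^{n+1}\mid x\cdot\theta\le\gamma(\theta)\}$, where $\cdot$ is the standard scalar product. The dual convex integrand (dual) of a convex integrand $\gamma$ is the convex integrand $\delta:S^n\to\mathbb{R}_+$ with $\mathrm{inv}(\mathrm{graph}(\delta))=\partial\mathcal{W}_\gamma$, where $\partial\mathcal{W}_\gamma$ is the boundary of $\mathcal{W}_\gamma$. The functions $\widehat{\gamma},\widehat{\delta}:S^n\to\mathbb{R}_+$ are $\widehat{\gamma}(\theta)=1/\gamma(-\theta)$ and $\widehat{\delta}(\theta)=1/\delta(-\theta)$. $C^\infty(S^n,\mathbb{R}_+)$ is the set of $C^\infty$ functions $S^n\to\mathbb{R}_+$ with the Whitney $C^\infty$ topology. Two elements $\gamma_1,\gamma_2\in C^\infty(S^n,\mathbb{R}_+)$ are $\mathcal{A}$-equivalent if there exist $C^\infty$ diffeomorphisms $h:S^n\to S^n$ and $H:\mathbb{R}_+\to\mathbb{R}_+$ with $\gamma_1=H\circ\gamma_2\circ h^{-1}$. A $C^\infty$ function in $C^\infty(S^n,\mathbb{R}_+)$ is stable if its $\mathcal{A}$-equivalence class is open in $C^\infty(S^n,\mathbb{R}_+)$ (in particular a stable function is of class $C^\infty$). The Morse index of a $C^\infty$ function $f$ on $S^n$ at a non-degenerate critical point $\theta$ is the integer $i$ such that, in some coordinate neighborhood $(U,\varphi)$ of $\theta$ with $\varphi(\theta)=\mathbf 0$, $f\circ\varphi^{-1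}(x_1,\ldots,x_n)=f(\theta)-x_1^2-\cdots-x_i^2+x_{i+1}^2+\cdots+x_n^2$.
   Formalization: The dual convex integrand δ is additionally assumed to be of class C^∞; without this, e.g. when inv(graph(γ)) has zero curvature at the point (like y=-1+x^4), δ need not be C^2 and (2), (4) are meaningless or fail while (1) holds. *)

(* Defs.v *)
(* A map on the sphere S^n (or on any subset of 'rV_n.+1) is represented by a
   total function; all predicates below depend only on its values on the
   relevant subset. *)
From HB Require Import structures.
From mathcomp Require Import all_boot all_order all_algebra.
From mathcomp Require Import all_classical all_reals all_analysis.
Import Order.TTheory GRing.Theory Num.Theory.
Import numFieldNormedType.Exports.

Set Implicit Arguments.
Unset Strict Implicit.
Unset Printing Implicit Defensive.

Local Open Scope classical_set_scope.
Local Open Scope ring_scope.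

Section Euclidean.
Variables (R : realType) (m : nat).
Implicit Types (x y : 'rV[R]_m) (A : set 'rV[R]_m).

Definition dotr x y : R := \sum_(j < m) x 0 j * y 0 j.

(* The library norm of 'rV_m is the sup norm: it induces the same topology,
   but the unit sphere has to be defined with the Euclidean norm. *)
Definition enorm x : R := Num.sqrt (dotr x x).

Definition boundary A : set 'rV[R]_m := closure A `\` interior A.

Definition convex_hull A : set 'rV[R]_m :=
  smallest (@convex_set R 'rV[R]_m) A.

End Euclidean.

(* The unit sphere S^n of R^(n+1). *)
Definition sphere (R : realType) (n : nat) : set 'rV[R]_n.+1 :=
  [set x | enorm x = 1].

Section Smooth.
Variables (R : realType) (m : nat) (W : normedModType R).
Implicit Types (f g : 'rV[R]_m -> W) (A O : set 'rV[R]_m).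

Definition iter_partial (s : seq 'I_m) f : 'rV[R]_m -> W :=
  foldr (fun j g => 'D_('e_j) g) f s.

(* Meaningful for an open O. *)
Definition smooth_open O f : Prop :=
  forall (s : seq 'I_m) x, O x ->
    {for x, continuous (iter_partial s f)} /\
    forall j : 'I_m, derivable (iter_partial s f) x 'e_j.

(* Smoothness on an arbitrary subset of R^m: local existence of smooth
   extensions to open sets.  On the embedded submanifold S^n this is the usual
   smoothness of a map between manifolds. *)
Definition smooth_on A f : Prop :=
  forall x, A x -> exists O g,
    [/\ open O, O x, smooth_open O g & forall y, A y -> O y -> g y = f y].

End Smooth.

Section Sphere.
Variables (R : realType) (n : nat).
Local Notation S := (@sphere R n).
Local Notation E := 'rV[R]_n.+1.
Implicit Types (f g : E -> R) (theta : E).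

(* A C^oo coordinate neighbourhood (U, phi) of the manifold S^n, together with
   an inverse of phi: the map chart_map is a C^oo diffeomorphism of the open
   subset chart_dom of S^n onto the open subset chart_cod of R^n. *)
Record sphere_chart : Type := SphereChart {
  chart_dom : set E;
  chart_map : E -> 'rV[R]_n;
  chart_inv : 'rV[R]_n -> E;
  chart_cod := chart_map @` chart_dom;
  chart_dom_open : exists2 O : set E, open O & chart_dom = S `&` O;
  chart_cod_open : open chart_cod;
  chart_mapK : {in chart_dom, cancel chart_map chart_inv};
  chart_map_smooth : smooth_on chart_dom chart_map;
  chart_inv_smooth : smooth_on chart_cod chart_inv
}.

Definition pos_on_sphere f : Prop := forall theta, S theta -> 0 < f theta.

(* Membership in C^oo(S^n, R_+). *)
Definition Coo_pos f : Prop := smooth_on S f /\ pos_on_sphere f.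

(* Basic neighbourhood of f in the Whitney C^oo topology: g is e_i-close to f
   on the compact subset K_i of the chart c_i, up to the derivatives of order r.
   As S^n is compact, the locally finite families of charts occurring in the
   definition of this topology are finite; the inclusion of R_+ in R serves as
   the chart of the target. *)
Definition whitney_close (r p : nat) (c : 'I_p -> sphere_chart)
    (K : 'I_p -> set E) (e : 'I_p -> R) f g : Prop :=
  forall i theta, K i theta -> forall s : seq 'I_n, (size s <= r)%N ->
    `|iter_partial s (g \o chart_inv (c i)) (chart_map (c i) theta) -
      iter_partial s (f \o chart_inv (c i)) (chart_map (c i) theta)| < e i.

(* Openness in C^oo(S^n, R_+) of the set of the elements of C^oo(S^n, R_+)
   that belong to F. *)
Definition whitney_open (F : set (E -> R)) : Prop :=
  forall f, Coo_pos f -> F f ->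
    exists (r p : nat) (c : 'I_p -> sphere_chart)
           (K : 'I_p -> set E) (e : 'I_p -> R),
      (forall i, [/\ compact (K i), K i `<=` chart_dom (c i) & 0 < e i]) /\
      forall g, Coo_pos g -> whitney_close r c K e f g -> F g.

(* h is a C^oo diffeomorphism of S^n with inverse k. *)
Definition sphere_diffeo (h k : E -> E) : Prop :=
  [/\ set_fun S S h, set_fun S S k, {in S, cancel h k} & {in S, cancel k h}] /\
  smooth_on S h /\ smooth_on S k.

Definition smooth_pos (H : R -> R) : Prop :=
  forall (k : nat) (t : R), 0 < t -> derivable (derive1n k H) t 1.

(* H is a C^oo diffeomorphism of R_+ with inverse K. *)
Definition pos_diffeo (H K : R -> R) : Prop :=
  [/\ forall t, 0 < t -> 0 < H t, forall t, 0 < t -> 0 < K t,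
      forall t, 0 < t -> K (H t) = t & forall t, 0 < t -> H (K t) = t] /\
  smooth_pos H /\ smooth_pos K.

Definition A_equivalent f g : Prop :=
  exists (h k : E -> E) (H K : R -> R),
    [/\ sphere_diffeo h k, pos_diffeo H K &
        forall theta, S theta -> f theta = H (g (k theta))].

Definition stable f : Prop :=
  Coo_pos f /\ whitney_open [set g | Coo_pos g /\ A_equivalent g f].

(* The point with polar coordinates (theta, r). *)
Definition polar theta (r : R) : E := r *: theta.

(* For x != 0, the polar coordinates of x are (x / |x|, |x|). *)
Definition inv (x : E) : E := polar (- ((enorm x)^-1 *: x)) (enorm x)^-1.

Definition graph f : set E := [set polar theta (f theta) | theta in S].

Definition convex_integrand f : Prop :=
  [/\ {within S, continuous f}, pos_on_sphere f &
      boundary (convex_hull (inv @` graph f)) = inv @` graph f].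

Definition wulff_shape f : set E :=
  \bigcap_(theta in S) [set x | dotr x theta <= f theta].

(* d is the dual convex integrand of f.  It need not be of class C^oo when f is:
   d is not C^2 where the hypersurface inv (graph f) has zero curvature. *)
Definition dual_convex_integrand f d : Prop :=
  convex_integrand d /\ inv @` graph d = boundary (wulff_shape f).

Definition hat f : E -> R := fun theta => (f (- theta))^-1.

Definition hessian (u : 'rV[R]_n -> R) (x : 'rV[R]_n) : 'M[R]_n :=
  \matrix_(j, k) iter_partial [:: j; k] u x.

(* The two conditions do not depend on the chart around theta. *)
Definition nondegenerate_critical_point f theta : Prop :=
  exists2 c : sphere_chart, chart_dom c theta &
    let u := f \o chart_inv c in let x := chart_map c theta in
    (forall j, 'D_('e_j) u x = 0) /\ \det (hessian u x) != 0.

Definition morse_index f theta (i : nat) : Prop :=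
  exists c : sphere_chart,
    [/\ chart_dom c theta, chart_map c theta = 0 &
        forall x, chart_cod c x ->
          f (chart_inv c x) = f theta - \sum_(k < n | (k < i)%N) x 0 k ^+ 2
                                      + \sum_(k < n | (i <= k)%N) x 0 k ^+ 2].

Definition nondegenerate_critical_of_index f theta (i : nat) : Prop :=
  nondegenerate_critical_point f theta /\ morse_index f theta i.

End Sphere.

(* Main.v *)
(* Put b(y) = delta(-y).  Convexity of gamma and duality say that
   x.y <= gamma(x) b(y) on the sphere, with equality for some y when x is given
   and for some x when y is given: gamma is the support function of the Wulff
   shape and 1/b is its radial function.  Let H be the 1-homogeneous extension of
   gamma.  At a contact pair (x, y), minimality of H(x) b(y) - x.y in x gives
   b(y) grad H(x) = y, so G = grad H / |grad H| is a diffeomorphism of the sphere,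
   its inverse being built in the same way from b, and (1/b) o G = |grad H|.

   In a chart at theta0 where gamma = h + q(x), with q(x) = x^T D x and D a
   diagonal matrix of signs, |grad H|^2 = gamma^2 + 4 x^T D M(x) D x where M is
   the Gram matrix of the gradients of the coordinates.  Hence
   1/b = h + x^T E(x) x in the chart transported by G, with
   E(0) = D + (2/h) D M(0) D.  As b is smooth, H is bounded from below to second
   order at theta0, which shows that E(0) is positive definite on the positive
   coordinates of D and that its inverse is negative definite on the negative
   ones.  Then the variables can be eliminated one after the other, smoothly in x
   and without pivoting, and the inverse function theorem turns E(x) into D.

   This is (1) => (4).  Passing from f to 1/f turns the index i into n - i, and
   the roles of gamma and b are symmetric, which gives the other implications. *)
Require Import Defs.
From HB Require Import structures.
From mathcomp Require Import all_boot all_order all_algebra.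
From mathcomp Require Import all_classical all_reals all_analysis.
From mathcomp Require Import ring lra zify.
Import Order.TTheory GRing.Theory Num.Theory.
Import numFieldNormedType.Exports.
Set Implicit Arguments.
Unset Strict Implicit.
Unset Printing Implicit Defensive.
Local Open Scope classical_set_scope.
Local Open Scope ring_scope.

(** * Differentiability and partial derivatives *)

(** [morse_index] asks for a chart in which the function is exactly a signed sum of squares, so
    comparing Hessians is not enough: a chart has to be constructed for each function, and
    non-degeneracy is then read off from the normal form. The delicate point is the sign of E(0).
    Adding the nonnegative form (2/h) D M(0) D to D is harmless in the positive directions but may
    flip a negative one: for n = 1 and D = -1, E(0) is negative exactly when M(0) < h/2. In arc
    length s, gamma is then h - M(0) s^2 to second order, and gamma + gamma'', the radius of
    curvature of the boundary of the Wulff shape, is h - 2 M(0). A larger M(0) contradicts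
    convexity; M(0) = h/2 is the borderline case of infinite curvature, in which the dual function
    is not C^2. The smoothness of [delta] excludes this case, so it has to be used at second order
    and must yield a strict inequality. *)

Section Differentials.
Variables (R : realType) (m : nat).
Implicit Types (f : 'rV[R]_m -> R) (x v h : 'rV[R]_m) (L : 'I_m -> R).

Lemma coord_norm_le x (j : 'I_m) : `|x 0 j| <= `|x|.
Proof.
rewrite [leRHS]/Num.Def.normr/= mx_normrE.
exact: (le_bigmax _ (fun i => `|x i.1 i.2|) (0, j)).
Qed.

Lemma row_norm_le x (e : R) : 0 <= e -> (forall j, `|x 0 j| <= e) -> `|x| <= e.
Proof.
move=> e0 xe; rewrite [leLHS]/Num.Def.normr/= mx_normrE.
by apply: bigmax_le => // -[i j] _ /=; rewrite ord1.
Qed.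

Lemma differentiableI f x L :
  (forall e, 0 < e -> \forall h \near (0 : 'rV[R]_m),
     `|f (h + x) - f x - \sum_j L j * h 0 j| <= e * `|h|) ->
  differentiable f x /\ forall j, 'D_('e_j) f x = L j.
Proof.
move=> fL.
pose l := fun h : 'rV[R]_m => \sum_j L j * h 0 j.
have l_lin : linear l.
  move=> a u v; rewrite /l scaler_sumr -big_split; apply: eq_bigr => j _ /=.
  by rewrite !mxE mulrDr mulrCA.
pose llM := GRing.isLinear.Build _ _ _ _ l l_lin.
pose ll : {linear 'rV[R]_m -> R} := HB.pack l llM.
have lc : continuous l.
  apply: (@continuous_big R _ +%R 0 xpredT _ _ _ (fun j (h : 'rV[R]_m) => L j * h 0 j)).
    exact: add_continuous.
  move=> j _ u; apply: continuousM; first exact: cst_continuous.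
  exact: coord_continuous.
have fl : f \o shift x = cst (f x) + (ll : 'rV[R]_m -> R) +o_ (0 : 'rV[R]_m) id.
  apply/eqaddoP => _/posnumP[e]; apply: filterS (fL _ (gt0 e)) => h /=.
  by rewrite !fctE /= opprD addrA.
have dE : 'd f x = ll :> ('rV[R]_m -> R) by apply: diff_unique.
have df : differentiable f x by apply/diff_locallyP; rewrite dE.
split=> // j; rewrite deriveE// dE /= /l (bigD1 j)//= !mxE !eqxx mulr1.
by rewrite big1 ?addr0// => k /negPf kj; rewrite mxE kj andbF mulr0.
Qed.

Lemma derive_partials f x v : differentiable f x ->
  'D_v f x = \sum_j 'D_('e_j) f x * v 0 j.
Proof.
move=> df; rewrite deriveE// {1}(row_sum_delta v) linear_sum.
by apply: eq_bigr => j _; rewrite linearZ deriveE// mulrC.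
Qed.

Lemma differentiableE f x : differentiable f x ->
  forall e, 0 < e -> \forall h \near (0 : 'rV[R]_m),
     `|f (h + x) - f x - \sum_j 'D_('e_j) f x * h 0 j| <= e * `|h|.
Proof.
move=> df e e0.
have /diff_locally/eqaddoP/(_ _ e0) := df.
apply: filterS => h /=; rewrite !fctE /= opprD addrA.
by rewrite -derive_partials// deriveE.
Qed.

Lemma shift_near x (P : 'rV[R]_m -> Prop) :
  (\forall y \near x, P y) -> \forall h \near (0 : 'rV[R]_m), P (h + x).
Proof.
move=> /nbhs_ballP[e e0 xP]; apply/nbhs_ballP; exists e => //= h.
rewrite -!ball_normE /= sub0r normrN => he; apply: xP.
by rewrite -ball_normE /= opprD addrCA subrr addr0 normrN.
Qed.

Lemma is_derive_line f x v (t : R) : derivable f (x + t *: v) v ->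
  is_derive t 1 (fun u : R => f (x + u *: v)) ('D_v f (x + t *: v)).
Proof.
set g := fun u : R => f (x + u *: v).
have gE : (fun h : R => h^-1 *: ((g \o shift t) (h *: 1) - g t)) =
    (fun h : R => h^-1 *: ((f \o shift (x + t *: v)) (h *: v) - f (x + t *: v))).
  apply/funext => h; rewrite /g /= [h *: 1]mulr1; congr (_ *: (f _ - _)).
  by rewrite scalerDl addrCA.
by move=> df; split; [rewrite /derivable gE | rewrite /derive gE].
Qed.

(** The factor c is kept apart from v so that only derivatives in the direction v occur, for
    instance along ['e_k]; as the parameter runs over [0, 1], c may vanish or be negative. *)
Lemma segment_MVT f x v (c : R) :
  (forall t : R, 0 <= t <= 1 -> derivable f (x + (c * t) *: v) v) ->
  exists2 t, 0 <= t <= 1 & f (x + c *: v) - f x = c * 'D_v f (x + (c * t) *: v).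
Proof.
move=> df; pose g (t : R) := f (x + (c * t) *: v).
have gd (t : R) : 0 <= t <= 1 -> is_derive t 1 g ('D_v f (x + (c * t) *: v) * c).
  move=> t01; have gt := is_derive_line (df t t01).
  apply: (@is_derive1_comp _ (fun u : R => f (x + u *: v)) (fun u : R => c * u)).
  have -> : (fun u : R => c * u) = c \*: (id : R -> R) by [].
  by apply: is_derive_eq; rewrite [_ *: _]mulr1.
have gI (t : R) : t \in `]0, 1[ -> is_derive t 1 g ('D_v f (x + (c * t) *: v) * c).
  by rewrite in_itv /= => /andP[t0 t1]; apply: gd; rewrite !ltW.
have gc : {within `[0, 1], continuous g}.
  apply: derivable_within_continuous => t; rewrite in_itv /= => t01.
  by have [] := gd t t01.
have [t tI gt] := MVT_segment ler01 gI gc.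
exists t; first by move: tI; rewrite in_itv.
by move: gt; rewrite /g !mulr1 mulr0 scale0r addr0 subr0 mulr1 mulrC.
Qed.

Lemma partials_differentiable f x :
  (\forall y \near x, forall j, derivable f y 'e_j) ->
  (forall j, {for x, continuous ('D_('e_j) f)}) -> differentiable f x.
Proof.
move=> df cf.
suff /differentiableI[] : forall e, 0 < e -> \forall h \near (0 : 'rV[R]_m),
    `|f (h + x) - f x - \sum_j 'D_('e_j) f x * h 0 j| <= e * `|h| by [].
(* The m coordinate increments below contribute an error e' * [|h|] each; [m.+1] keeps the divisor
   nonzero when m = 0. *)
move=> e e0; pose e' := e / m.+1%:R.
have e'0 : 0 < e' by rewrite divr_gt0.
have : \forall y \near x, (forall j, derivable f y 'e_j) /\
    forall j, `|'D_('e_j) f x - 'D_('e_j) f y| <= e'.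
  apply: (filterI df).
  apply: (@filter_forall 'rV[R]_m 'I_m
    (fun j y => `|'D_('e_j) f x - 'D_('e_j) f y| <= e') _ (nbhs_filter x)) => j.
  by move/cvgrPdist_le : (cf j) => /(_ _ e'0).
move=> /nbhs_ballP[r r0 xr]; apply/nbhs_ballP; exists r => //= h.
rewrite -ball_normE /= sub0r normrN => hr.
(* The path from x to h + x is cut into segments parallel to the axes, on each of which only one
   partial derivative is involved. *)
pose hk k := \row_j (if (j < k)%N then h 0 j else 0) : 'rV[R]_m.
have hkS (k : 'I_m) : hk k.+1 = hk k + h 0 k *: 'e_k.
  apply/rowP => j; rewrite !mxE eqxx /= ltnS leq_eqVlt.
  have [->|jk] := eqVneq j k; first by rewrite eqxx ltnn add0r mulr1.
  by rewrite (negPf (jk : val j != val k)) mulr0 addr0.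
have hk_le (k : 'I_m) (t : R) : 0 <= t <= 1 -> `|hk k + (h 0 k * t) *: 'e_k| <= `|h|.
  move=> /andP[t0 t1]; apply: row_norm_le => // j; rewrite !mxE eqxx /=.
  have [->|jk] := eqVneq j k; last first.
    by rewrite mulr0 addr0; case: ifP; rewrite ?normr0// coord_norm_le.
  rewrite ltnn add0r mulr1 normrM (ger0_norm t0).
  by apply: le_trans (coord_norm_le h k); rewrite ler_piMr.
have step (k : 'I_m) :
    `|f (hk k.+1 + x) - f (hk k + x) - 'D_('e_k) f x * h 0 k| <= e' * `|h|.
  have inball (t : R) : 0 <= t <= 1 -> ball x r (hk k + x + (h 0 k * t) *: 'e_k).
    move=> t01; rewrite -ball_normE /= addrAC opprD addrCA subrr addr0 normrN.
    exact: le_lt_trans (hk_le k t t01) hr.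
  have [|t t01] := @segment_MVT f (hk k + x) 'e_k (h 0 k).
    by move=> t t01; have [+ _] := xr _ (inball t t01); exact.
  rewrite hkS addrAC => ->; rewrite mulrC -mulrBl normrM distrC.
  apply: ler_pM => //; last exact: coord_norm_le.
  by have [_] := xr _ (inball t t01); exact.
have -> : f (h + x) - f x = \sum_(k < m) (f (hk k.+1 + x) - f (hk k + x)).
  rewrite -(big_mkord xpredT (fun k => f (hk k.+1 + x) - f (hk k + x))).
  rewrite (telescope_sumr (fun k => f (hk k + x)))//.
  congr (f (_ + x) - f _).
    by apply/rowP => j; rewrite mxE ltn_ord.
  by rewrite -[LHS]add0r; congr (_ + _); apply/rowP => j; rewrite !mxE.
rewrite -sumrB; apply: le_trans (ler_norm_sum _ _ _) _.
apply: (@le_trans _ _ (\sum_(k < m) e' * `|h|)); first exact: ler_sum.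
rewrite sumr_const card_ord -mulr_natr mulrAC ler_wpM2r//.
by rewrite /e' -mulrA ler_piMr ?(ltW e0)// mulrC ler_pdivrMr// mul1r ler_nat.
Qed.

End Differentials.

(** * Calculus of smooth functions *)

Section Smoothness.
Variables (R : realType) (m : nat).
Implicit Types (O : set 'rV[R]_m) (f g : 'rV[R]_m -> R).

(* Unlike smooth_open, this asks for Frechet differentiability at every order,
   so that the chain rule can be iterated. *)
Fixpoint Ck (k : nat) O f : Prop :=
  if k is k'.+1 then
    (forall x, O x -> differentiable f x) /\ forall j : 'I_m, Ck k' O ('D_('e_j) f)
  else forall x, O x -> {for x, continuous f}.

Definition smooth O f := forall k, Ck k O f.

Lemma smooth_diff O f x : smooth O f -> O x -> differentiable f x.
Proof. by move=> /(_ 1%N)[+ _] => /[apply]. Qed.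

Lemma smooth_derive O f (j : 'I_m) : smooth O f -> smooth O ('D_('e_j) f).
Proof. by move=> sf k; have [_] := sf k.+1; exact. Qed.

Lemma smooth_continuous O f x : smooth O f -> O x -> {for x, continuous f}.
Proof. by move=> /(_ 0%N); exact. Qed.

Lemma CkS k O f : Ck k.+1 O f -> Ck k O f.
Proof.
elim: k f => [|k IH] f /= [df Df].
  by move=> x Ox; exact/differentiable_continuous/df.
by split=> // j; exact: IH.
Qed.

Lemma Ck_sub k O O' f : O' `<=` O -> Ck k O f -> Ck k O' f.
Proof.
move=> sO; elim: k f => [|k IH] f /=; first by move=> cf x /sO/cf.
by case=> df Df; split=> [x /sO/df //|j]; exact: IH.
Qed.

Lemma near_open O (P : 'rV[R]_m -> Prop) x :
  open O -> O x -> (forall y, O y -> P y) -> \forall y \near x, P y.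
Proof. by move=> oO Ox OP; apply: filterS OP _; exact: open_nbhs_nbhs. Qed.

Lemma near_eq_differentiable f g x : (\forall y \near x, f y = g y) ->
  differentiable f x -> differentiable g x.
Proof.
move=> fg df; suff /differentiableI[] : forall e, 0 < e ->
    \forall h \near (0 : 'rV[R]_m),
    `|g (h + x) - g x - \sum_j 'D_('e_j) f x * h 0 j| <= e * `|h| by [].
move=> e e0; have := shift_near fg; have := differentiableE df e0.
apply: filterS2 => h; rewrite (nbhs_singleton fg) => + <-; exact.
Qed.

Lemma Ck_ext k O f g : open O -> (forall x, O x -> f x = g x) ->
  Ck k O f -> Ck k O g.
Proof.
move=> oO; elim: k f g => [|k IH] f g fg /=.
  move=> cf x Ox; change (g @ x --> g x); rewrite -(fg x Ox).
  apply: (cvg_trans (@near_eq_cvg _ _ (nbhs x) (nbhs_filter x) f g _) (cf x Ox)).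
  exact: (near_open oO Ox).
case=> df Df; split=> [x Ox|j].
  by apply: near_eq_differentiable (df x Ox); exact: (near_open oO Ox).
apply: IH (Df j) => x Ox; apply: near_eq_derive.
exact: (near_open oO Ox).
Qed.

Lemma Ck_cst k O (c : R) : Ck k O (fun=> c).
Proof.
elim: k c => [|k IH] c /=; first by move=> x _; exact: cst_continuous.
split=> [x _|j]; first exact: differentiable_cst.
have -> : 'D_('e_j) (fun _ : 'rV[R]_m => c) = fun=> 0.
  by apply/funext => x; exact: derive_cst.
exact: IH.
Qed.

Lemma derive_coord (i : 'I_m) (v : 'rV[R]_m) (x : 'rV[R]_m) :
  'D_v (fun y : 'rV[R]_m => y 0 i) x = v 0 i.
Proof.
have /derivable_mxP dv := @derivable_id R 'rV[R]_m x v.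
have := derive_id x v; rewrite derive_mx; last exact/derivable_mxP.
by move=> /rowP/(_ i); rewrite mxE.
Qed.

Lemma Ck_coord k O (i : 'I_m) : Ck k O (fun y => y 0 i).
Proof.
case: k => [|k] /=; first by move=> x _; exact: coord_continuous.
split=> [x _|j]; first exact: differentiable_coord.
have -> : 'D_('e_j) (fun y : 'rV[R]_m => y 0 i) = fun=> ('e_j : 'rV[R]_m) 0 i.
  by apply/funext => x; exact: derive_coord.
exact: Ck_cst.
Qed.

Lemma Ck_add k O f g : open O -> Ck k O f -> Ck k O g -> Ck k O (fun x => f x + g x).
Proof.
move=> oO; elim: k f g => [|k IH] f g /=.
  by move=> cf cg x Ox; apply: continuousD; [exact: cf | exact: cg].
move=> [df Df] [dg Dg]; split=> [x Ox|j].
  by apply: differentiableD; [exact: df | exact: dg].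
apply: Ck_ext (IH _ _ (Df j) (Dg j)) => // x Ox.
by apply/esym/deriveD; [exact/diff_derivable/df | exact/diff_derivable/dg].
Qed.

Lemma Ck_mul k O f g : open O -> Ck k O f -> Ck k O g -> Ck k O (fun x => f x * g x).
Proof.
move=> oO; elim: k f g => [|k IH] f g.
  by move=> cf cg x Ox; apply: continuousM; [exact: cf | exact: cg].
move=> sf sg; have [[df Df] [dg Dg]] := (sf, sg); split=> [x Ox|j].
  by apply: differentiableM; [exact: df | exact: dg].
apply: (@Ck_ext _ _ (fun x => f x * 'D_('e_j) g x + g x * 'D_('e_j) f x)) => //.
  move=> x Ox; apply/esym.
  by apply: deriveM; [exact/diff_derivable/df | exact/diff_derivable/dg].
by apply: (Ck_add oO (IH _ _ (CkS sf) (Dg j)) (IH _ _ (CkS sg) (Df j))).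
Qed.

Lemma Ck_sum k O (I : Type) (r : seq I) (P : pred I) (F : I -> 'rV[R]_m -> R) :
  open O -> (forall i, P i -> Ck k O (F i)) ->
  Ck k O (fun x => \sum_(i <- r | P i) F i x).
Proof.
move=> oO sF; elim: r => [|i r IH].
  by apply: Ck_ext (Ck_cst k O 0) => // x _; rewrite big_nil.
case Pi: (P i); last by apply: Ck_ext IH => // x _; rewrite big_cons Pi.
by apply: Ck_ext (Ck_add oO (sF i Pi) IH) => // x _; rewrite big_cons Pi.
Qed.

(** The derivative - f' / f^2 contains only f' and 1/f, both already of class C^k, so f stays fixed
    in the induction. The same scheme gives [Ck_sqrt]. *)
Lemma Ck_inv k O f : open O -> (forall x, O x -> f x != 0) ->
  Ck k O f -> Ck k O (fun x => (f x)^-1).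
Proof.
move=> oO f0; elim: k => [|k IH].
  by move=> cf x Ox; apply: continuousV; [exact: f0 | exact: cf].
move=> sf; have [df Df] := sf; split=> [x Ox|j].
  by apply: differentiableV; [exact: df | exact: f0].
have sV := IH (CkS sf).
apply: (@Ck_ext _ _ (fun x => (- 1) * ((f x)^-1 * (f x)^-1) * 'D_('e_j) f x)) => //.
  move=> x Ox; rewrite deriveV ?f0//; last exact/diff_derivable/df.
  by rewrite mulN1r -invfM -expr2.
exact: (Ck_mul oO (Ck_mul oO (Ck_cst k O _) (Ck_mul oO sV sV)) (Df j)).
Qed.

Lemma Ck_sqrt k O f : open O -> (forall x, O x -> 0 < f x) ->
  Ck k O f -> Ck k O (fun x => Num.sqrt (f x)).
Proof.
move=> oO f0; elim: k => [|k IH].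
  move=> cf x Ox; apply: (@continuous_comp _ _ _ f Num.sqrt); first exact: cf.
  exact: sqrt_continuous.
move=> sf; have [df Df] := sf.
have sqd x : O x -> differentiable (Num.sqrt : R -> R) (f x).
  move=> Ox; apply/derivable1_diffP.
  by have [] := is_derive1_sqrt (f0 x Ox).
split=> [x Ox|j].
  by apply: (@differentiable_comp _ _ _ _ f Num.sqrt); [exact: df | exact: sqd].
apply: (@Ck_ext _ _ (fun x => 2^-1 * (Num.sqrt (f x))^-1 * 'D_('e_j) f x)) => //.
  move=> x Ox; rewrite -invfM.
  have dc : differentiable (Num.sqrt \o f) x.
    by apply: differentiable_comp; [exact: df | exact: sqd].
  rewrite (deriveE _ dc) diff_comp//=; [|exact: df|exact: sqd].
  rewrite -(deriveE _ (df x Ox)).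
  have sd := is_derive1_sqrt (f0 x Ox).
  by rewrite deriv1E ?derive1E ?derive_val//= mulrC.
have sV : Ck k O (fun x => (Num.sqrt (f x))^-1).
  apply: Ck_inv => //; last exact: IH (CkS sf).
  by move=> x Ox; rewrite gt_eqF// sqrtr_gt0 f0.
exact: (Ck_mul oO (Ck_mul oO (Ck_cst k O _) sV) (Df j)).
Qed.

Lemma smooth_open_derive (W : normedModType R) O (F : 'rV[R]_m -> W) j :
  smooth_open O F -> smooth_open O ('D_('e_j) F).
Proof.
(* [foldr] applies the last index of the sequence first. *)
move=> sF s x Ox; have := sF (rcons s j) x Ox.
by rewrite /iter_partial foldr_rcons.
Qed.

(** Bridge from the definition by partial derivatives to the one that supports the chain rule:
    continuous partial derivatives give Frechet differentiability at each order. *)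
Lemma smooth_open_smooth O f : open O -> smooth_open O f -> smooth O f.
Proof.
move=> oO + k; elim: k f => [|k IH] f sf; first by move=> x /(sf [::])[].
split=> [x Ox|j]; last exact/IH/smooth_open_derive.
apply: partials_differentiable => [|j].
  by apply: (near_open oO Ox) => y /(sf [::])[].
by have [+ _] := sf [:: j] x Ox.
Qed.

Lemma smooth_iter_partial O f s : smooth O f -> smooth O (iter_partial s f).
Proof. by move=> sf; elim: s => //= j s; exact: smooth_derive. Qed.

Lemma smooth_smooth_open O f : smooth O f -> smooth_open O f.
Proof.
move=> sf s x Ox; have ss := smooth_iter_partial s sf.
split; first exact: smooth_continuous Ox.
by move=> j; exact/diff_derivable/(smooth_diff ss).
Qed.

Lemma smooth_sub O O' f : O' `<=` O -> smooth O f -> smooth O' f.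
Proof. by move=> sO sf k; exact: Ck_sub (sf k). Qed.

Lemma smooth_ext O f g : open O -> (forall x, O x -> f x = g x) ->
  smooth O f -> smooth O g.
Proof. by move=> oO fg sf k; exact: Ck_ext (sf k). Qed.

Lemma smooth_cst O (c : R) : smooth O (fun=> c).
Proof. by move=> k; exact: Ck_cst. Qed.

Lemma smooth_coord O (i : 'I_m) : smooth O (fun y => y 0 i).
Proof. by move=> k; exact: Ck_coord. Qed.

Lemma smooth_add O f g : open O -> smooth O f -> smooth O g ->
  smooth O (fun x => f x + g x).
Proof. by move=> oO sf sg k; exact: Ck_add. Qed.

Lemma smooth_mul O f g : open O -> smooth O f -> smooth O g ->
  smooth O (fun x => f x * g x).
Proof. by move=> oO sf sg k; exact: Ck_mul. Qed.

Lemma smooth_opp O f : open O -> smooth O f -> smooth O (fun x => - f x).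
Proof.
move=> oO sf.
by apply: smooth_ext (smooth_mul oO (smooth_cst O (-1)) sf) => // x _; rewrite mulN1r.
Qed.

Lemma smooth_sum O (I : Type) (r : seq I) (P : pred I) (F : I -> 'rV[R]_m -> R) :
  open O -> (forall i, P i -> smooth O (F i)) ->
  smooth O (fun x => \sum_(i <- r | P i) F i x).
Proof. by move=> oO sF k; apply: Ck_sum => // i Pi; exact: sF. Qed.

Lemma smooth_inv O f : open O -> (forall x, O x -> f x != 0) ->
  smooth O f -> smooth O (fun x => (f x)^-1).
Proof. by move=> oO f0 sf k; exact: Ck_inv. Qed.

Lemma smooth_sqrt O f : open O -> (forall x, O x -> 0 < f x) ->
  smooth O f -> smooth O (fun x => Num.sqrt (f x)).
Proof. by move=> oO f0 sf k; exact: Ck_sqrt. Qed.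

End Smoothness.

(** * Smooth maps with vector values, composition, and inversion of matrices *)

Section VectorSmoothness.
Variables (R : realType) (m p : nat).
Implicit Types (O : set 'rV[R]_m) (F : 'rV[R]_m -> 'rV[R]_p).

Definition vsmooth O F := forall i, smooth O (fun x => F x 0 i).

Lemma continuous_coords F x :
  (forall i, {for x, continuous (fun y => F y 0 i)}) -> {for x, continuous F}.
Proof.
move=> cF; apply/(@cvgrPdist_le R 'rV[R]_p _ (nbhs x) (nbhs_filter x)) => e e0.
suff : \forall y \near x, forall i : 'I_p, `|F x 0 i - F y 0 i| <= e.
  apply: (@filterS _ _ (nbhs_filter x)) => y Fy.
  apply: row_norm_le => [|i]; first exact: ltW.
  by rewrite !mxE.
apply: (@filter_forall 'rV[R]_m 'I_p (fun i y => `|F x 0 i - F y 0 i| <= e)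
  _ (nbhs_filter x)) => i.
by have /cvgrPdist_le/(_ e e0) := cF i.
Qed.

Lemma vsmooth_continuous O F x : vsmooth O F -> O x -> {for x, continuous F}.
Proof.
move=> sF Ox; apply: continuous_coords => i; exact: smooth_continuous (sF i) Ox.
Qed.

Lemma vsmooth_sub O O' F : O' `<=` O -> vsmooth O F -> vsmooth O' F.
Proof. by move=> sO sF i; exact: smooth_sub (sF i). Qed.

Lemma differentiable_coords F x :
  (forall i, differentiable (fun y => F y 0 i) x) -> differentiable F x.
Proof.
move=> dF.
have -> : F = \sum_(i < p) (fun y => F y 0 i *: ('e_i : 'rV[R]_p)).
  by apply/funext => y; rewrite fct_sumE [LHS]row_sum_delta.
by apply: differentiable_sum => i; exact: differentiableZl.
Qed.

Lemma smooth_open_coords O F : open O ->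
  smooth_open O F <-> vsmooth O F.
Proof.
move=> oO; split=> sF.
  move=> i; apply: smooth_open_smooth => //.
  have partialE s x : O x ->
      iter_partial s F x 0 i = iter_partial s (fun y => F y 0 i) x.
    elim: s x => // j s IH x Ox /=.
    have [_ /(_ j) ds] := sF s x Ox.
    rewrite derive_mx// mxE; apply: near_eq_derive; exact: (near_open oO Ox).
  move=> s x Ox; have [cs ds] := sF s x Ox; split; last first.
    move=> j; apply: near_eq_derivable ((derivable_mxP _ _ _).1 (ds j) 0 i).
    exact: (near_open oO Ox (partialE s)).
  change (iter_partial s (fun y => F y 0 i) @ x --> iter_partial s (fun y => F y 0 i) x).
  rewrite -partialE//.
  have := @continuous_comp _ _ _ (iter_partial s F) (fun v : 'rV[R]_p => v 0 i) x cs
    (@coord_continuous _ _ _ _ _ _).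
  apply: cvg_trans.
  apply: (@near_eq_cvg _ _ (nbhs x) (nbhs_filter x)).
  exact: (near_open oO Ox (partialE s)).
(* Derivability at order s needs the coordinate formula at order s only; with this formula as a
   hypothesis, it can be used inside the induction that proves the formula. *)
have dpartial s x (j : 'I_m) : O x ->
    (forall y i, O y -> iter_partial s F y 0 i = iter_partial s (fun z => F z 0 i) y) ->
    derivable (iter_partial s F) x 'e_j.
  move=> Ox sE; apply: (derivable_mxP _ _ _).2 => i0 k; rewrite ord1.
  have dk : derivable (iter_partial s (fun z => F z 0 k)) x 'e_j.
    exact: diff_derivable (smooth_diff (smooth_iter_partial s (sF k)) Ox).
  by apply: near_eq_derivable dk; apply: (near_open oO Ox) => y Oy; rewrite sE.
have partialE s x i : O x ->
    iter_partial s F x 0 i = iter_partial s (fun y => F y 0 i) x.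
  elim: s x i => // j s IH x i Ox /=.
  rewrite derive_mx; last exact: dpartial.
  rewrite mxE; apply: near_eq_derive; apply: (near_open oO Ox) => y Oy; exact: IH.
move=> s x Ox; split; last by move=> j; apply: dpartial => // y i; exact: partialE.
apply: continuous_coords => i.
have cs := smooth_continuous (smooth_iter_partial s (sF i)) Ox.
change ((fun y => iter_partial s F y 0 i) @ x --> iter_partial s F x 0 i).
rewrite partialE//; apply: (cvg_trans _ cs).
apply: (@near_eq_cvg _ _ (nbhs x) (nbhs_filter x)).
by apply: (near_open oO Ox) => y Oy; rewrite partialE.
Qed.

End VectorSmoothness.

Section Composition.
Variables (R : realType) (m p : nat).
Implicit Types (O : set 'rV[R]_m) (Q : set 'rV[R]_p) (F : 'rV[R]_m -> 'rV[R]_p).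
Implicit Types (f : 'rV[R]_p -> R).

Lemma vsmooth_differentiable O F x : vsmooth O F -> O x -> differentiable F x.
Proof. by move=> sF Ox; apply: differentiable_coords => i; exact: smooth_diff (sF i) Ox. Qed.

Lemma derive_comp F f x v : differentiable F x -> differentiable f (F x) ->
  'D_v (f \o F) x = \sum_i 'D_('e_i) f (F x) * 'D_v (fun y => F y 0 i) x.
Proof.
move=> dF df; rewrite deriveE; last exact: differentiable_comp.
rewrite diff_comp//= -(deriveE _ dF) -(deriveE _ df) derive_partials//.
apply: eq_bigr => i _; congr (_ * _).
by rewrite derive_mx ?mxE//; exact: diff_derivable.
Qed.

Lemma Ck_comp k O Q F f : open O -> open Q -> (forall x, O x -> Q (F x)) ->
  (forall i, Ck k O (fun x => F x 0 i)) -> Ck k Q f -> Ck k O (f \o F).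
Proof.
move=> oO oQ FQ; elim: k f => [|k IH] f sF sf.
  move=> x Ox; apply: continuous_comp; last exact/sf/FQ.
  by apply: continuous_coords => i; exact: sF.
have dF x : O x -> differentiable F x.
  by move=> Ox; apply: differentiable_coords => i; have [+ _] := sF i; exact.
have [df Df] := sf; split=> [x Ox|j].
  by apply: differentiable_comp; [exact: dF | exact/df/FQ].
apply: (@Ck_ext _ _ _ _ (fun x => \sum_(i < p) 'D_('e_i) f (F x) *
    'D_('e_j) (fun y => F y 0 i) x)) => //.
  by move=> x Ox; rewrite derive_comp//; [exact: dF | exact/df/FQ].
apply: Ck_sum => // i _; apply: Ck_mul => //; last by have [_ /(_ j)] := sF i.
by apply: (IH _ _ (Df i)) => i'; exact/CkS/sF.
Qed.

Lemma smooth_comp O Q F f : open O -> open Q -> (forall x, O x -> Q (F x)) ->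
  vsmooth O F -> smooth Q f -> smooth O (f \o F).
Proof. by move=> oO oQ FQ sF sf k; apply: (Ck_comp oO oQ FQ) => // i; exact: sF. Qed.

End Composition.

Lemma vsmooth_comp (R : realType) (m p q : nat) (O : set 'rV[R]_m) (Q : set 'rV[R]_p)
    (F : 'rV[R]_m -> 'rV[R]_p) (G : 'rV[R]_p -> 'rV[R]_q) :
  open O -> open Q -> (forall x, O x -> Q (F x)) ->
  vsmooth O F -> vsmooth Q G -> vsmooth O (G \o F).
Proof.
move=> oO oQ FQ sF sG i.
exact: (@smooth_comp _ _ _ O Q F (fun y => G y 0 i)).
Qed.

Section MatrixSmoothness.
Variables (R : realType) (m : nat).
Implicit Types (O : set 'rV[R]_m).

Lemma smooth_prod O (I : Type) (r : seq I) (P : pred I) (F : I -> 'rV[R]_m -> R) :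
  open O -> (forall i, P i -> smooth O (F i)) ->
  smooth O (fun x => \prod_(i <- r | P i) F i x).
Proof.
move=> oO sF; elim: r => [|i r IH].
  by apply: smooth_ext (smooth_cst O 1) => // x _; rewrite big_nil.
case Pi: (P i); last by apply: smooth_ext IH => // x _; rewrite big_cons Pi.
by apply: smooth_ext (smooth_mul oO (sF i Pi) IH) => // x _; rewrite big_cons Pi.
Qed.

Lemma smooth_det O p (A : 'rV[R]_m -> 'M[R]_p) : open O ->
  (forall i j, smooth O (fun x => A x i j)) -> smooth O (fun x => \det (A x)).
Proof.
move=> oO sA; apply: smooth_sum => // s _; apply: smooth_mul => //.
  exact: smooth_cst.
exact: smooth_prod.
Qed.

(** Cramer's rule: the entries of the inverse are cofactors divided by the determinant. *)
Lemma smooth_invmx O p (A : 'rV[R]_m -> 'M[R]_p) i j : open O ->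
  (forall x, O x -> A x \in unitmx) ->
  (forall i j, smooth O (fun x => A x i j)) -> smooth O (fun x => invmx (A x) i j).
Proof.
move=> oO uA sA.
apply: (@smooth_ext _ _ _ (fun x => (\det (A x))^-1 *
    ((-1) ^+ (j + i) * \det (row' j (col' i (A x)))))) => //.
  by move=> x Ox; rewrite /invmx uA// !mxE.
apply: smooth_mul => //; first apply: smooth_inv => //.
- by move=> x /uA; rewrite unitmxE unitfE.
- exact: smooth_det.
- apply: smooth_mul => //; first exact: smooth_cst.
  apply: smooth_det => // k l; apply: smooth_ext (sA (lift j k) (lift i l)) => // x _.
  by rewrite !mxE.
Qed.

End MatrixSmoothness.

(** * Inverse function theorem *)

Section InverseFunction.
Variables (R : realType) (m : nat).
Implicit Types (O : set 'rV[R]_m) (F a : 'rV[R]_m -> 'rV[R]_m) (x y : 'rV[R]_m).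

(** Transpose of the usual Jacobian matrix, so that the differential acts on row vectors by
    [h *m Jac F x]. *)
Definition Jac F x : 'M[R]_m := \matrix_(i, j) 'D_('e_i) (fun y => F y 0 j) x.

Lemma closed_ball_compact (r : R) : compact [set x : 'rV[R]_m | `|x| <= r].
Proof.
apply: bounded_closed_compact.
  exists r; split; first exact: num_real.
  by move=> M rM x /= xr; exact: le_trans xr (ltW rM).
apply: (@closed_comp _ _ (fun x : 'rV[R]_m => `|x|) [set t | t <= r]).
  by move=> x _; exact: norm_continuous.
exact: closed_le.
Qed.

Lemma half_contraction_fixpoint (r : R) (T : 'rV[R]_m -> 'rV[R]_m) : 0 <= r ->
  (forall x, `|x| <= r -> `|T x| <= r) ->
  (forall x y, `|x| <= r -> `|y| <= r -> `|T x - T y| <= 2^-1 * `|x - y|) ->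
  exists2 x, `|x| <= r & T x = x.
Proof.
move=> r0 Tr Tc; pose B := [set x : 'rV[R]_m | `|x| <= r].
have cf : {within B, continuous (fun x => `|T x - x|)}.
  apply/subspace_continuousP => x Bx.
  apply/(@cvgrPdist_le R R _ (within B (nbhs x)) (within_filter B (nbhs_filter x))) => e e0.
  apply/nbhs_ballP; exists (e / 2); first by rewrite /= divr_gt0.
  move=> y; rewrite -ball_normE /= => xy By.
  apply: le_trans (ler_dist_dist _ _) _.
  have -> : T x - x - (T y - y) = (T x - T y) - (x - y).
    by rewrite !opprB addrACA [RHS]addrACA [- x + _]addrC.
  apply: le_trans (ler_normB _ _) _.
  have := Tc x y Bx By; have := normr_ge0 (x - y); lra.
(* A point minimizing |T x - x| on the compact ball is fixed: T would otherwise
   halve the minimum. *)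
have B0 : B !=set0 by exists 0; rewrite /B /= normr0.
have [x] := EVT_min_rV B0 (@closed_ball_compact r) cf.
rewrite inE => Bx minx; exists x => //; apply/eqP; rewrite -subr_eq0 -normr_eq0.
have := minx (T x); rewrite inE => /(_ (Tr x Bx)) h.
have := Tc (T x) x (Tr x Bx) Bx.
rewrite eq_le normr_ge0 andbT => h2.
by have := normr_ge0 (T x - x); lra.
Qed.

(** In the sup norm each coordinate is treated separately, by the mean value theorem on the segment
    from y to x; m partial derivatives of size at most 1 / (2 (m + 1)) sum to at most 1/2. *)
Lemma small_partials_contraction (r : R) (phi : 'rV[R]_m -> 'rV[R]_m) :
  (forall x, `|x| <= r -> forall j, differentiable (fun y => phi y 0 j) x) ->
  (forall x, `|x| <= r -> forall i j, `|Jac phi x i j| <= (2 * m.+1%:R)^-1) ->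
  forall x y, `|x| <= r -> `|y| <= r -> `|phi x - phi y| <= 2^-1 * `|x - y|.
Proof.
move=> dphi Jphi x y xr yr.
apply: row_norm_le => [|j]; first by rewrite mulr_ge0// invr_ge0.
have seg (t : R) : 0 <= t <= 1 -> `|y + (1 * t) *: (x - y)| <= r.
  move=> /andP[t0 t1]; rewrite mul1r.
  have -> : y + t *: (x - y) = (1 - t) *: y + t *: x.
    by rewrite scalerBr scalerBl scale1r addrA addrAC.
  apply: le_trans (ler_normD _ _) _; rewrite !normrZ (ger0_norm t0) ger0_norm ?subr_ge0//.
  have -> : r = (1 - t) * r + t * r by ring.
  by apply: lerD; apply: ler_wpM2l; rewrite ?subr_ge0.
have [|t t01] := @segment_MVT _ _ (fun y => phi y 0 j) y (x - y) 1.
  by move=> t t01; apply: diff_derivable; apply: dphi; exact: seg.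
rewrite scale1r [y + _]addrC subrK mul1r !mxE => ->.
rewrite derive_partials; last by apply: dphi; exact: seg.
apply: le_trans (ler_norm_sum _ _ _) _.
apply: (@le_trans _ _ (\sum_(i < m) (2 * m.+1%:R)^-1 * `|x - y|)).
  apply: ler_sum => i _; rewrite normrM; apply: ler_pM => //; last exact: coord_norm_le.
  by have := Jphi _ (seg t t01) i j; rewrite mxE.
rewrite sumr_const card_ord -[leLHS]mulr_natr mulrAC; apply: ler_wpM2r => //.
by rewrite invfM -mulrA ler_piMr ?invr_ge0// mulrC ler_pdivrMr// mul1r ler_nat.
Qed.

Lemma mulmx_norm_le (B : 'M[R]_m) : exists2 C : R, 0 < C &
  forall v : 'rV[R]_m, `|v *m B| <= C * `|v|.
Proof.
pose C : R := 1 + \sum_i \sum_j `|B i j|.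
have S0 : 0 <= \sum_i \sum_j `|B i j| by apply: sumr_ge0 => i _; apply: sumr_ge0.
exists C; first by rewrite /C; lra.
move=> v; apply: row_norm_le => [|j]; first by rewrite mulr_ge0// /C; lra.
rewrite mxE; apply: le_trans (ler_norm_sum _ _ _) _.
apply: (@le_trans _ _ (\sum_i `|B i j| * `|v|)).
  apply: ler_sum => i _; rewrite normrM mulrC ler_wpM2l//; exact: coord_norm_le.
rewrite -mulr_suml ler_wpM2r// /C.
apply: (@le_trans _ _ (\sum_i \sum_j `|B i j|)); last by lra.
by apply: ler_sum => i _; rewrite (bigD1 j)//= lerDl sumr_ge0.
Qed.


Lemma near0_ball (P : 'rV[R]_m -> Prop) : (\forall x \near (0 : 'rV[R]_m), P x) ->
  exists2 r, 0 < r & forall x, `|x| <= r -> P x.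
Proof.
move=> /nbhs_ballP[e e0 eP]; exists (e / 2); first by rewrite divr_gt0.
move=> x xe; apply: eP; rewrite -ball_normE /= sub0r normrN.
by apply: le_lt_trans xe _; rewrite ltr_pdivrMr// ltr_pMr// ltr1n.
Qed.

Lemma smooth_JacS O F i j : vsmooth O F -> smooth O (fun x => Jac F x i j).
Proof.
move=> sF; have := smooth_derive i (sF j); congr (smooth O _).
by apply/funext => x; rewrite mxE.
Qed.

Lemma small_partials_near O a : open O -> O 0 -> vsmooth O a -> Jac a 0 = 1%:M ->
  exists r, [/\ 0 < r, (forall x, `|x| <= r -> O x) &
    (forall x, `|x| <= r -> forall i j,
      `|Jac (fun x => x - a x) x i j| <= (2 * m.+1%:R)^-1)].
Proof.
move=> oO O0 sa Ja; pose phi x := x - a x.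
have sphi : vsmooth O phi.
  move=> j; apply: (@smooth_ext _ _ _ (fun x => x 0 j + - a x 0 j)) => //.
    by move=> x _; rewrite !mxE.
  by apply: smooth_add => //; [exact: smooth_coord | exact: smooth_opp].
have Jphi0 i j : Jac phi 0 i j = 0.
  rewrite mxE; have -> : (fun y => phi y 0 j) =
      (fun y : 'rV[R]_m => y 0 j) - (fun y => a y 0 j).
    by apply/funext => y; rewrite !mxE.
  rewrite deriveB; last 2 first.
  - exact/diff_derivable/differentiable_coord.
  - exact: diff_derivable (smooth_diff (sa j) O0).
  rewrite derive_coord mxE eqxx /=.
  by have /matrixP/(_ i j) := Ja; rewrite !mxE eq_sym => ->; rewrite subrr.
have e0 : 0 < (2 * m.+1%:R)^-1 :> R by rewrite invr_gt0 mulr_gt0.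
have : \forall x \near (0 : 'rV[R]_m), O x /\
    forall i j, `|Jac phi x i j| <= (2 * m.+1%:R)^-1.
  apply: (filterI (near_open oO O0 (fun x Ox => Ox))).
  apply: (@filter_forall 'rV[R]_m 'I_m (fun i x => forall j, `|Jac phi x i j| <= _)
    _ (nbhs_filter (0 : 'rV[R]_m))) => i.
  apply: (@filter_forall 'rV[R]_m 'I_m (fun j x => `|Jac phi x i j| <= _)
    _ (nbhs_filter (0 : 'rV[R]_m))) => j.
  have := smooth_continuous (smooth_JacS i j sphi) O0.
  move/(@cvgrPdist_le R R _ (nbhs (0 : 'rV[R]_m)) (nbhs_filter _)) => /(_ _ e0).
  apply: (@filterS _ _ (nbhs_filter _)) => x /=.
  by rewrite Jphi0 sub0r normrN.
by move=> /near0_ball[r r0 rP]; exists r; split=> // x /rP[].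
Qed.

(** For h = b (k + y) - b y and A the Jacobian of [a] at b y, k A^-1 - h = (k - h A) A^-1.
    Differentiability of [a] makes k - h A small relative to h, hence relative to k by the Lipschitz
    bound C; K bounds the norm of A^-1. *)
Lemma differentiable_inverse a (b : 'rV[R]_m -> 'rV[R]_m) y :
  differentiable a (b y) -> Jac a (b y) \in unitmx ->
  (\forall z \near y, a (b z) = z) ->
  (exists2 C, 0 < C & \forall z \near y, `|b z - b y| <= C * `|z - y|) ->
  forall j, differentiable (fun z => b z 0 j) y /\
    forall i, 'D_('e_i) (fun z => b z 0 j) y = invmx (Jac a (b y)) i j.
Proof.
move=> da; set x := b y; set A := Jac a x => uA ab [C C0 bC] j.
apply: differentiableI => e e0.
have [K K0 AK] := mulmx_norm_le (invmx A).
pose e' := e / (K * C).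
have e'0 : 0 < e' by rewrite divr_gt0 ?mulr_gt0.
have dal : \forall h \near (0 : 'rV[R]_m), `|a (h + x) - a x - h *m A| <= e' * `|h|.
  suff : \forall h \near (0 : 'rV[R]_m), forall l : 'I_m,
      `|a (h + x) 0 l - a x 0 l - \sum_i 'D_('e_i) (fun z => a z 0 l) x * h 0 i| <= e' * `|h|.
    apply: filterS => h hl; apply: row_norm_le => [|l]; first by rewrite mulr_ge0// ltW.
    apply: le_trans (hl l); rewrite !mxE.
    by under [in leRHS]eq_bigr do rewrite mulrC; under [in leLHS]eq_bigr do rewrite mxE.
  apply: (@filter_forall 'rV[R]_m 'I_m (fun l h => `|a (h + x) 0 l - a x 0 l -
    \sum_i 'D_('e_i) (fun z => a z 0 l) x * h 0 i| <= e' * `|h|)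
    _ (nbhs_filter (0 : 'rV[R]_m))) => l.
  apply: (@differentiableE _ _ (fun z => a z 0 l)) => //.
  exact: (@differentiable_comp _ _ _ _ a (fun v : 'rV[R]_m => v 0 l) _ da
    (@differentiable_coord _ _ _ _ _ _)).
have [r r0 rP] := near0_ball dal.
have : \forall k \near (0 : 'rV[R]_m), [/\ a (b (k + y)) = k + y,
    `|b (k + y) - x| <= C * `|k| & `|k| <= r / C].
  have rC0 : 0 < r / C by rewrite divr_gt0.
  have near_k : \forall k \near (0 : 'rV[R]_m), `|k| <= r / C.
    exact: nbhs0_le.
  have near_b : \forall k \near (0 : 'rV[R]_m),
      a (b (k + y)) = k + y /\ `|b (k + y) - b y| <= C * `|k + y - y|.
    exact: shift_near (filterI ab bC).
  by apply: filterS (filterI near_k near_b) => k [kr [abk]]; rewrite addrK.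
apply: filterS => k [abk bk kr].
pose h := b (k + y) - x.
have hr : `|h| <= r.
  apply: le_trans bk _; rewrite mulrC -ler_pdivlMr//.
have := rP h hr; rewrite /h subrK abk => hA.
have ax : a x = y by exact: nbhs_singleton ab.
rewrite ax addrK in hA.
have -> : b (k + y) 0 j - x 0 j - \sum_i invmx A i j * k 0 i =
   - ((k - h *m A) *m invmx A) 0 j.
  rewrite mulmxBl mulmxK// !mxE opprB; congr (_ - _).
  by apply: eq_bigr => i _; rewrite mulrC.
rewrite normrN; apply: le_trans (coord_norm_le _ _) _.
apply: le_trans (AK _) _.
rewrite -ler_pdivlMl//; apply: le_trans hA _.
apply: le_trans (ler_wpM2l (ltW e'0) bk) _.
rewrite le_eqVlt; apply/orP; left; apply/eqP.
by rewrite /e'; field; rewrite !gt_eqF.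
Qed.


(** The equation a x = y is the fixed point equation x = phi x + y, where phi = id - a has zero
    Jacobian at 0 and is thus a contraction of factor 1/2 near 0. *)
Lemma inverse_function_id O a : open O -> O 0 -> a 0 = 0 -> vsmooth O a ->
  Jac a 0 = 1%:M ->
  exists (U V : set 'rV[R]_m) (b : 'rV[R]_m -> 'rV[R]_m),
    [/\ [/\ open U, U 0 & U `<=` O], open V /\ V 0, vsmooth V b,
        forall y, V y -> U (b y) /\ a (b y) = y &
        forall x, U x -> V (a x) -> b (a x) = x].
Proof.
move=> oO O0 a0 sa Ja; have [r [r0 rO rJ]] := small_partials_near oO O0 sa Ja.
pose phi x := x - a x.
have sphi : vsmooth O phi.
  move=> j; apply: (@smooth_ext _ _ _ (fun x => x 0 j + - a x 0 j)) => //.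
    by move=> x _; rewrite !mxE.
  by apply: smooth_add => //; [exact: smooth_coord | exact: smooth_opp].
have dphi x j : O x -> differentiable (fun y => phi y 0 j) x.
  by move=> Ox; exact: smooth_diff (sphi j) Ox.
have cphi := small_partials_contraction (fun x xr j => dphi x j (rO x xr)) rJ.
have phi0 : phi 0 = 0 by rewrite /phi a0 subr0.
have phi_le x : `|x| <= r -> `|phi x| <= 2^-1 * `|x|.
  move=> xr; have := cphi x 0 xr; rewrite phi0 !subr0 normr0; apply; exact: ltW.
(* This gives at once the injectivity of [a] on the ball and the Lipschitz bound required by
   [differentiable_inverse]. *)
have a_expand x y : `|x| <= r -> `|y| <= r -> `|x - y| <= 2 * `|a x - a y|.
  move=> xr yr; have := cphi x y xr yr.
  have -> : phi x - phi y = (x - y) - (a x - a y).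
    by rewrite /phi !opprB addrACA [RHS]addrACA [- a x + _]addrC.
  have := lerB_dist (x - y) (a x - a y); lra.
pose V := [set y : 'rV[R]_m | `|y| < r / 2]; pose U := [set x : 'rV[R]_m | `|x| < r].
(* The condition on y lies under the existential so that choice yields a total function b. *)
have fix_ex y : exists x, V y -> U x /\ a x = y.
  have [Vy|nV] := pselect (V y); last by exists 0.
  have [] := @half_contraction_fixpoint r (fun x => phi x + y); first exact: ltW.
  - move=> x xr; apply: le_trans (ler_normD _ _) _.
    have := phi_le x xr; move: Vy; rewrite /V /=; lra.
  - by move=> x z xr zr; rewrite opprD addrACA subrr addr0; exact: cphi.
  move=> x xr xE; exists x => _.
  have axy : a x = y.
    have : x - a x + y = x by exact: xE.
    by move/eqP; rewrite -subr_eq0 addrAC [x - _]addrC addrK addrC subr_eq0 => /eqP.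
  split=> //; rewrite /U /= -xE; apply: le_lt_trans (ler_normD _ _) _.
  have := phi_le x xr; move: Vy; rewrite /V /=; lra.
pose b y := sval (cid (fix_ex y)).
have bP y : V y -> U (b y) /\ a (b y) = y by exact: (svalP (cid (fix_ex y))).
have openball t : open [set x : 'rV[R]_m | `|x| < t].
  apply: (@open_comp _ _ (fun x : 'rV[R]_m => `|x|) [set u | u < t]).
    by move=> x _; exact: norm_continuous.
  exact: open_lt.
have oV : open V by exact: openball.
have oU : open U by exact: openball.
have UO : U `<=` O by move=> x /ltW/rO.
(* A row v killed by the Jacobian of [a] is fixed by that of phi, which at least halves norms on
   U. *)
have uJ x : U x -> Jac a x \in unitmx.
  move=> Ux; rewrite -row_free_unit; apply: inj_row_free => v vA.
  have vE : v = v *m Jac phi x.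
    rewrite -[LHS]subr0 -[X in v - X]vA -[X in X - _]mulmx1 -mulmxBr; congr (_ *m _).
    apply/matrixP => i j; rewrite !mxE.
    have -> : (fun y => phi y 0 j) = (fun y : 'rV[R]_m => y 0 j) - (fun y => a y 0 j).
      by apply/funext => y; rewrite !mxE.
    rewrite deriveB; last 2 first.
    - exact/diff_derivable/differentiable_coord.
    - exact: diff_derivable (smooth_diff (sa j) (UO _ Ux)).
    by rewrite derive_coord mxE eqxx /= eq_sym.
  have : `|v| <= 2^-1 * `|v|.
    apply: row_norm_le => [|j]; first by rewrite mulr_ge0// invr_ge0.
    rewrite {1}vE mxE; apply: le_trans (ler_norm_sum _ _ _) _.
    apply: (@le_trans _ _ (\sum_(i < m) (2 * m.+1%:R)^-1 * `|v|)).
      apply: ler_sum => i _; rewrite normrM mulrC; apply: ler_pM => //.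
        exact: rJ (ltW Ux) _ _.
      exact: coord_norm_le.
    rewrite sumr_const card_ord -[leLHS]mulr_natr mulrAC; apply: ler_wpM2r => //.
    by rewrite invfM -mulrA ler_piMr ?invr_ge0// mulrC ler_pdivrMr// mul1r ler_nat.
  by move=> v2; apply/eqP; rewrite -normr_eq0 eq_le normr_ge0 andbT; lra.
have db y j : V y -> differentiable (fun z => b z 0 j) y /\
    forall i, 'D_('e_i) (fun z => b z 0 j) y = invmx (Jac a (b y)) i j.
  move=> Vy; have [Uby aby] := bP y Vy.
  apply: differentiable_inverse.
  - exact: vsmooth_differentiable sa (UO _ Uby).
  - exact: uJ.
  - by apply: (near_open oV Vy) => z /bP[].
  - exists 2 => //; apply: (near_open oV Vy) => z Vz; have [Ubz abz] := bP z Vz.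
    by rewrite -{2}abz -{2}aby; apply: a_expand; exact: ltW.
exists U, V, b; split => //.
- by split=> //; rewrite /U /= normr0.
- by split=> //; rewrite /V /= normr0 divr_gt0.
(* Bootstrap: the partial derivatives of b are entries of the inverse Jacobian of [a] composed with
   b, so b of class C^k is of class C^(k+1). *)
- move=> j k; elim: k j => [|k IH] j.
    by move=> y Vy; have [d _] := db y j Vy; exact: differentiable_continuous.
  split=> [y Vy|i]; first by have [] := db y j Vy.
  apply: (@Ck_ext _ _ _ _ ((fun x => invmx (Jac a x) i j) \o b)) => //.
    by move=> y Vy /=; have [_ ->] := db y j Vy.
  apply: (@Ck_comp _ _ _ _ _ U) => //; first by move=> y /bP[].
  have : smooth U (fun x => invmx (Jac a x) i j); last exact.
  apply: smooth_invmx => // i' j'; apply: smooth_JacS.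
  exact: vsmooth_sub sa.
- move=> x Ux Vax; have [Ub ab] := bP _ Vax.
  apply/eqP; rewrite -subr_eq0 -normr_le0.
  by apply: le_trans (a_expand _ _ (ltW Ub) (ltW Ux)) _; rewrite ab subrr normr0 mulr0.
Qed.


Lemma smooth_mulmx O F (B : 'M[R]_m) : open O -> vsmooth O F ->
  vsmooth O (fun x => F x *m B).
Proof.
move=> oO sF j; apply: (@smooth_ext _ _ _ (fun x => \sum_i F x 0 i * B i j)) => //.
  by move=> x _; rewrite mxE.
by apply: smooth_sum => // i _; apply: smooth_mul => //; exact: smooth_cst.
Qed.

(** Composing with the inverse of the Jacobian at 0 reduces to the case of the identity. *)
Theorem inverse_function O a : open O -> O 0 -> a 0 = 0 -> vsmooth O a ->
  Jac a 0 \in unitmx ->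
  exists (U V : set 'rV[R]_m) (b : 'rV[R]_m -> 'rV[R]_m),
    [/\ [/\ open U, U 0 & U `<=` O], open V /\ V 0, vsmooth V b,
        forall y, V y -> U (b y) /\ a (b y) = y &
        forall x, U x -> V (a x) -> b (a x) = x].
Proof.
move=> oO O0 a0 sa uJ; set J := Jac a 0 in uJ *.
pose a' x := a x *m invmx J.
have sa' : vsmooth O a' by exact: smooth_mulmx.
have a'0 : a' 0 = 0 by rewrite /a' a0 mul0mx.
have Ja' : Jac a' 0 = 1%:M.
  rewrite -(mulmxV uJ); apply/matrixP => i j; rewrite !mxE.
  have -> : (fun y => a' y 0 j) = \sum_(l < m) invmx J l j *: (fun y => a y 0 l : R).
    by apply/funext => y; rewrite /a' mxE fct_sumE; apply: eq_bigr => l _; rewrite mulrC.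
  have da l : derivable (fun y => a y 0 l) 0 'e_i.
    exact: diff_derivable (smooth_diff (sa l) O0).
  rewrite derive_sum; last by move=> l; exact: derivableZ.
  by apply: eq_bigr => l _; rewrite deriveZ// mxE mulrC.
have [U [V [b [UO [oV V0] sb bP baK]]]] := inverse_function_id oO O0 a'0 sa' Ja'.
pose W := [set y : 'rV[R]_m | V (y *m invmx J)].
have slin : vsmooth setT (fun y : 'rV[R]_m => y *m invmx J).
  by apply: (@smooth_mulmx _ id) => [|i]; [exact: openT | exact: smooth_coord].
exists U, W, (b \o (fun y => y *m invmx J)); split; [by []|idtac|idtac|idtac|idtac].
- split; last by rewrite /W /= mul0mx.
  by apply: open_comp oV => y _; exact: (vsmooth_continuous slin).
- apply: (@vsmooth_comp _ _ _ _ _ V) => //; last exact: vsmooth_sub slin.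
  by apply: open_comp oV => y _; exact: (vsmooth_continuous slin).
- move=> y Wy; have [Ub ab] := bP _ Wy; split=> //.
  by rewrite -[LHS]mulmx1 -(mulVmx uJ) mulmxA [X in X *m _]ab -mulmxA mulVmx// mulmx1.
- by move=> x Ux Wax /=; exact: baK.
Qed.

End InverseFunction.

(** * Smooth reduction of a quadratic form *)

Section SignedCholesky.
Variables (R : realType) (n : nat).
Implicit Types (O : set 'rV[R]_n) (v : 'I_n -> R) (A : 'I_n -> 'I_n -> R).

Definition quad A v : R := \sum_j v j * \sum_l A j l * v l.

Definition msign (i j : nat) : R := if (j < i)%N then -1 else 1.

Lemma msign_sq i j : msign i j * msign i j = 1.
Proof. by rewrite /msign; case: ifP; rewrite ?mulrNN mulr1. Qed.

(* The second condition says that the inverse form is negative definite on the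
   span of the first i coordinates; both conditions survive the elimination of
   the last variable, which is why no pivoting is needed. *)
Definition signed_form (i k : nat) A : Prop :=
  (forall v, (forall j : 'I_n, (k <= j)%N -> v j = 0) ->
     (forall j : 'I_n, (j < i)%N -> v j = 0) -> (exists j, v j != 0) ->
     0 < quad A v) /\
  (forall v, (forall j : 'I_n, (k <= j)%N -> v j = 0) ->
     (forall j : 'I_n, (j < k)%N -> (i <= j)%N -> \sum_l A j l * v l = 0) ->
     (exists j, v j != 0) -> quad A v < 0).

(** Schur complement of the pivot K. It keeps its full size, with zero row and column K when the
    pivot is nonzero, so that no reindexing occurs during the elimination. *)
Definition schur A (K : 'I_n) : 'I_n -> 'I_n -> R :=
  fun j l => A j l - A j K * A K l / A K K.

Lemma schur_row A K j v :
  \sum_l schur A K j l * v l =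
  \sum_l A j l * v l - A j K / A K K * \sum_l A K l * v l.
Proof.
rewrite mulr_sumr -sumrB; apply: eq_bigr => l _.
by rewrite /schur; ring.
Qed.

(** Completing the square in the variable K. *)
Lemma quad_schur A K v : (forall j l, A j l = A l j) ->
  quad A v = quad (schur A K) v + (\sum_l A K l * v l) ^+ 2 / A K K.
Proof.
move=> symA; rewrite /quad; under [X in _ = X + _]eq_bigr do rewrite schur_row mulrBr.
rewrite sumrB; set S := \sum_l A K l * v l.
have -> : \sum_j v j * (A j K / A K K * S) = S ^+ 2 / A K K.
  have -> : S ^+ 2 / A K K = \sum_j A K j * v j * (S / A K K).
    by rewrite -mulr_suml expr2 mulrA.
  by apply: eq_bigr => j _; rewrite symA; ring.
by rewrite subrK.
Qed.

Lemma schur_sym A K : (forall j l, A j l = A l j) ->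
  forall j l, schur A K j l = schur A K l j.
Proof. by move=> symA j l; rewrite /schur symA (symA j K) (symA K l) [A K j * _]mulrC. Qed.

Lemma schur_pivot A K j : A K K != 0 -> schur A K j K = 0.
Proof. by move=> K0; rewrite /schur mulfK// subrr. Qed.

Lemma sum_pointwise (F : 'I_n -> R) (K : 'I_n) v s :
  \sum_l F l * (v l + s *+ (l == K)) = \sum_l F l * v l + F K * s.
Proof.
under eq_bigr do rewrite mulrDr; rewrite big_split /=; congr (_ + _).
rewrite (bigD1 K)//= eqxx mulr1n big1 ?addr0// => l /negPf ->.
by rewrite mulr0n mulr0.
Qed.

Lemma quad_schur_pivot A K v s : (forall j l, A j l = A l j) -> A K K != 0 ->
  quad (schur A K) (fun l => v l + s *+ (l == K)) = quad (schur A K) v.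
Proof.
move=> symA K0; rewrite /quad.
have rowE j : \sum_l schur A K j l * (v l + s *+ (l == K)) = \sum_l schur A K j l * v l.
  by rewrite sum_pointwise schur_pivot// mul0r addr0.
under eq_bigr do rewrite rowE mulrC.
rewrite (sum_pointwise (fun j => \sum_l schur A K j l * v l)).
rewrite [X in _ + X * s]big1 ?mul0r ?addr0 => [|l _].
  by under eq_bigr do rewrite mulrC.
by rewrite schur_sym// schur_pivot// mul0r.
Qed.

(** Tested on the basis vector of K. If i <= K it is admissible in the positive clause; if K < i, no
    row index below [k.+1] reaches i, so the condition of the negative clause is void. *)
Lemma signed_form_pivot (i k : nat) A (K : 'I_n) : k = K -> signed_form i k.+1 A ->
  0 < msign i K * A K K.
Proof.
move=> kK [pos neg]; pose v (l : 'I_n) : R := 1 *+ (l == K).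
have rowE j : \sum_l A j l * v l = A j K.
  have := sum_pointwise (A j) K (fun=> 0) 1; rewrite mulr1 [X in _ = X + _]big1.
    by rewrite add0r => <-; apply: eq_bigr => l _; rewrite add0r.
  by move=> l _; rewrite mulr0.
have qE : quad A v = A K K.
  rewrite /quad (bigD1 K)//= /v eqxx mul1r -/(v _) rowE big1 ?addr0//.
  by move=> j /negPf ->; rewrite mul0r.
have v0 (j : 'I_n) : (k < j)%N -> v j = 0.
  by move=> kj; rewrite /v; case: eqVneq kj => // ->; rewrite kK ltnn.
have vn0 : exists j, v j != 0 by exists K; rewrite /v eqxx oner_eq0.
rewrite -qE /msign; case: ltnP => Ki.
  rewrite mulN1r oppr_gt0; apply: neg => // j jk ij.
  by move: (leq_trans Ki ij); rewrite -kK ltnNge -ltnS jk.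
rewrite mul1r; apply: pos => // j ji.
by rewrite /v; case: eqVneq ji => // ->; rewrite ltnNge Ki.
Qed.

Lemma signed_form_schur (i k : nat) A (K : 'I_n) : k = K -> (forall j l, A j l = A l j) ->
  signed_form i k.+1 A -> signed_form i k (schur A K).
Proof.
move=> kK symA sf; have := signed_form_pivot kK sf; have [pos neg] := sf => pivot.
have K0 : A K K != 0 by apply: contraTneq pivot => ->; rewrite mulr0 ltxx.
(* Coordinate K is adjusted so that row K of A vanishes on [w v]; there A and its Schur complement
   take the same values, and test vectors of the latter become test vectors of A. *)
pose w v (l : 'I_n) := v l + (- (\sum_l A K l * v l) / A K K) *+ (l == K).
have rowK v : \sum_l A K l * w v l = 0.
  by rewrite sum_pointwise mulrCA mulfV// mulr1 subrr.
have qw v : quad A (w v) = quad (schur A K) v.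
  by rewrite (quad_schur K)// rowK expr0n /= mul0r addr0 quad_schur_pivot.
have rowj v j : \sum_l A j l * w v l = \sum_l schur A K j l * v l.
  have := schur_row A K j (w v); rewrite rowK mulr0 subr0 => <-.
  by rewrite sum_pointwise schur_pivot// mul0r addr0.
have wsupp v : (forall j : 'I_n, (k <= j)%N -> v j = 0) ->
    forall j : 'I_n, (k < j)%N -> w v j = 0.
  move=> v0 j kj; rewrite /w v0 ?(ltnW kj)// add0r.
  by case: eqVneq kj => // ->; rewrite kK ltnn.
have wn0 v : (forall j : 'I_n, (k <= j)%N -> v j = 0) ->
    (exists j, v j != 0) -> exists j, w v j != 0.
  move=> v0 [j vj]; exists j; rewrite /w; case: (eqVneq j K) => [jK|_]; last by rewrite addr0.
  by move: vj; rewrite v0 ?eqxx// jK kK.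
split=> v v0.
  move=> vi vn0; rewrite -qw; apply: pos => //; [exact: wsupp| |exact: wn0].
  (* The case j = K does not arise: it would give K < i, and v, which vanishes below i and from k =
     K on, would be zero. *)
  move=> j ji; rewrite /w vi// add0r; case: eqVneq => // jK.
  have [l vl] := vn0; case: (leqP k l) => [/v0 vl0|lk]; first by rewrite vl0 eqxx in vl.
  by move: vl; rewrite vi ?eqxx// (ltn_trans lk)// kK -jK.
move=> vA vn0; rewrite -qw; apply: neg => //; [exact: wsupp| |exact: wn0].
move=> j; rewrite ltnS leq_eqVlt => /orP[/eqP jk _|jk ij].
  have -> : j = K by apply: val_inj; rewrite /= jk kK.
  exact: rowK.
by rewrite rowj vA.
Qed.


Lemma open_preimage_smooth O (f : 'rV[R]_n -> R) (V : set R) : open O -> smooth O f ->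
  open V -> open [set x | O x /\ V (f x)].
Proof.
move=> oO sf oV; rewrite openE => x [Ox Vx]; apply: filterI.
  exact: open_nbhs_nbhs.
by apply: (smooth_continuous sf Ox); exact: open_nbhs_nbhs.
Qed.

(** Induction on the number k of active variables; restricting to vectors v that vanish from k on
    stands for taking the leading block. The diagonal of L is controlled at 0 only, which is what
    the inverse function theorem will need. *)
Lemma smooth_signed_cholesky (i : nat) O (E : 'I_n -> 'I_n -> 'rV[R]_n -> R) k :
  (k <= n)%N -> open O -> O 0 -> (forall j l, smooth O (E j l)) ->
  (forall x, O x -> forall j l, E j l x = E l j x) ->
  signed_form i k (fun j l => E j l 0) ->
  exists (O' : set 'rV[R]_n) (L : 'I_n -> 'I_n -> 'rV[R]_n -> R),
    [/\ [/\ open O', O' 0 & O' `<=` O], forall j l, smooth O' (L j l),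
        forall (j l : 'I_n) x, (j < l)%N -> L j l x = 0, forall j, L j j 0 != 0 &
        forall x v, O' x -> (forall j : 'I_n, (k <= j)%N -> v j = 0) ->
          quad (fun j l => E j l x) v =
          \sum_(j < n | (j < k)%N) msign i j * (\sum_l L j l x * v l) ^+ 2].
Proof.
elim: k O E => [|k IH] O E kn oO O0 sE symE sfE.
  exists O, (fun j l _ => (j == l)%:R); split => //.
  - by split=> // x.
  - by move=> j l; exact: smooth_cst.
  - by move=> j l x jl; case: eqVneq jl => // ->; rewrite ltnn.
  - by move=> j; rewrite eqxx oner_eq0.
  - move=> x v Ox v0; rewrite big_pred0//.
    by rewrite /quad big1// => j _; rewrite v0 ?mul0r.
pose K := Ordinal kn; have kK : k = K by [].
(* By continuity the pivot keeps its sign near 0, so its square root is smooth there. *)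
pose O1 := [set x | O x /\ [set t | 0 < t] (msign i k * E K K x)].
have oO1 : open O1.
  apply: open_preimage_smooth => //.
  by apply: smooth_mul => //; exact: smooth_cst.
have sO1 : O1 `<=` O by move=> x [].
have O10 : O1 0 by split=> //; have := signed_form_pivot kK sfE; exact.
have sE1 j l : smooth O1 (E j l) by exact: smooth_sub (sE j l).
have EK x : O1 x -> E K K x != 0.
  by move=> [_] /=; apply: contraTneq => ->; rewrite mulr0 ltxx.
have sV : smooth O1 (fun x => (E K K x)^-1) by exact: smooth_inv.
have sS j l : smooth O1 (fun x => schur (fun j l => E j l x) K j l).
  apply: smooth_add => //; apply: smooth_opp => //.
  by apply: smooth_mul => //; exact: smooth_mul.
have symS x : O1 x -> forall j l, schur (fun j l => E j l x) K j l =
    schur (fun j l => E j l x) K l j.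
  by move=> /sO1 Ox j l; apply: schur_sym => j' l'; exact: symE.
have sfS : signed_form i k (schur (fun j l => E j l 0) K).
  by apply: signed_form_schur => // j l; exact: symE.
have [Q [L [[oQ Q0 sQ] sL tL dL qL]]] := IH O1 _ (ltnW kn) oO1 O10 sS symS sfS.
have sQO : Q `<=` O by move=> x /sQ/sO1.
pose rt x := Num.sqrt (msign i k * E K K x).
have srt : smooth Q rt.
  apply: smooth_sqrt => //; first by move=> x /sQ[].
  apply: smooth_mul => //; first exact: smooth_cst.
  exact: smooth_sub (sE1 K K).
(* Row K is the linear form of the completed square, scaled by the root of the absolute value of the
   pivot. It is cut off beyond k to stay triangular, which is harmless since v vanishes there. *)
exists Q, (fun (j l : 'I_n) x =>
  if j == K then if (l <= k)%N then rt x * (E K l x / E K K x) else 0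
  else L j l x); split => //.
- move=> j l; case: (j == K) => //; case: (l <= k)%N; last exact: smooth_cst.
  by apply: smooth_mul => //; apply: (smooth_sub sQ); exact: smooth_mul.
- move=> j l x jl; case: eqVneq => [jK|_]; last exact: tL.
  by rewrite leqNgt -[k in X in ~~ X]/(val K) -jK jl.
- move=> j; case: (eqVneq j K) => [->|_]; last exact: dL.
  rewrite leqnn divff ?EK// mulr1 gt_eqF// sqrtr_gt0; exact: O10.2.
move=> x v Qx v0; have O1x := sQ _ Qx.
have symx j l : E j l x = E l j x by apply: symE; exact: sQO.
have K0 := EK _ O1x.
rewrite (quad_schur K)//.
(* The Schur form ignores coordinate K; setting it to 0 makes the induction hypothesis applicable,
   and the triangular shape of L makes the rows j < k ignore it too. *)
pose v' l := v l + (- v K) *+ (l == K).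
have v'0 (j : 'I_n) : (k <= j)%N -> v' j = 0.
  rewrite leq_eqVlt => /orP[/eqP jk|jk].
    have -> : j = K by apply: val_inj; rewrite /= jk.
    by rewrite /v' eqxx mulr1n subrr.
  rewrite /v' v0// add0r; case: (eqVneq j K) jk => [->|_ _]; first by rewrite ltnn.
  by rewrite mulr0n.
rewrite -(quad_schur_pivot v (- v K) symx K0) -/v'.
rewrite (qL x v' Qx v'0) (bigD1 K (P := fun j : 'I_n => (j < k.+1)%N))//= addrC.
congr (_ + _); last first.
  rewrite eqxx; set S := \sum_l E K l x * v l.
  have -> : \sum_(l < n) (if (l <= k)%N then rt x * (E K l x / E K K x) else 0) * v l =
      rt x / E K K x * S.
    rewrite mulr_sumr; apply: eq_bigr => l _; case: leqP => [_|kl]; first by ring.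
    by rewrite v0// !mulr0.
  have rt2 : rt x ^+ 2 = msign i k * E K K x by rewrite sqr_sqrtr// ltW//; exact: O1x.2.
  rewrite exprMn expr_div_n rt2 -[LHS]mul1r -(msign_sq i k).
  by change (nat_of_ord K) with k; field.
apply: eq_big => [j|j jk].
  by rewrite ltnS ltn_neqAle andbC.
have -> : (j == K) = false by apply/negbTE; rewrite -val_eqE /= neq_ltn jk.
by rewrite /v' sum_pointwise tL ?mul0r ?addr0.
Qed.

End SignedCholesky.

(** * Normal forms in charts of the sphere *)

Section LocalSmoothness.
Variables (R : realType) (m p : nat).
Implicit Types (O : set 'rV[R]_m).

Lemma smooth_local O (f : 'rV[R]_m -> R) :
  (forall x, O x -> exists2 O', O' x & smooth O' f) -> smooth O f.
Proof.
move=> lf k; elim: k f lf => [|k IH] f lf.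
  by move=> x Ox; have [Q Qx /(_ 0%N)] := lf x Ox; exact.
split=> [x Ox|j].
  by have [Q Qx sf] := lf x Ox; exact: smooth_diff sf _.
apply: IH => x Ox; have [Q Qx sf] := lf x Ox.
by exists Q => //; exact: smooth_derive.
Qed.

Lemma open_preimage_vsmooth O (F : 'rV[R]_m -> 'rV[R]_p) (V : set 'rV[R]_p) :
  open O -> vsmooth O F -> open V -> open [set x | O x /\ V (F x)].
Proof.
move=> oO sF oV; rewrite openE => x [Ox Vx]; apply: filterI.
  exact: open_nbhs_nbhs.
by apply: (vsmooth_continuous sF Ox); exact: open_nbhs_nbhs.
Qed.

End LocalSmoothness.

Section SphereParam.
Variables (R : realType) (n : nat).
Local Notation S := (@sphere R n).
Implicit Types (f : 'rV[R]_n.+1 -> R) (theta z : 'rV[R]_n.+1) (x y : 'rV[R]_n).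
Implicit Types (W : set 'rV[R]_n) (P : 'rV[R]_n -> 'rV[R]_n.+1).
Implicit Types (O : set 'rV[R]_n.+1) (Phi : 'rV[R]_n.+1 -> 'rV[R]_n).

(* A chart of S^n centred at theta, with inverse P, whose chart map is the
   restriction to S^n of a map Phi defined on an open set of the ambient space. *)
Record sphere_param theta W P O Phi : Prop := SphereParam {
  param_openW : open W;
  param_W0 : W 0;
  param_openO : open O;
  param0 : P 0 = theta;
  param_smooth : vsmooth W P;
  param_inv_smooth : vsmooth O Phi;
  param_sphere : forall y, W y -> S (P y);
  param_dom : forall y, W y -> O (P y);
  param_invK : forall y, W y -> Phi (P y) = y;
  paramK : forall z, S z -> O z -> W (Phi z) -> P (Phi z) = z
}.

Definition qform (i : nat) x : R := \sum_(j < n) msign R i j * x 0 j ^+ 2.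

Definition morse_normal_form f theta i : Prop := exists W P O Phi,
  sphere_param theta W P O Phi /\ forall y, W y -> f (P y) = f theta + qform i y.

Lemma qformE i x : qform i x =
  - \sum_(k < n | (k < i)%N) x 0 k ^+ 2 + \sum_(k < n | (i <= k)%N) x 0 k ^+ 2.
Proof.
rewrite /qform (bigID (fun k : 'I_n => (k < i)%N)) /= -sumrN; congr (_ + _).
  by apply: eq_bigr => k ki; rewrite /msign ki mulN1r.
apply: eq_big => [k|k ki]; first by rewrite -leqNgt.
by rewrite /msign (negPf ki) mul1r.
Qed.

Lemma qform0 i : qform i 0 = 0.
Proof. by rewrite /qform big1// => j _; rewrite mxE expr0n mulr0. Qed.

(** Smoothness of the chart map provides an ambient extension g only near theta, so the chart is
    shrunk to the W on which g can serve as Phi. *)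
Lemma morse_index_normal_form f theta i : morse_index f theta i ->
  morse_normal_form f theta i.
Proof.
move=> [c [thc c0 fc]].
have [Q oQ domE] := chart_dom_open c.
have [Og [g [oO Oth sg gE]]] := chart_map_smooth thc.
have domS z : chart_dom c z <-> S z /\ Q z by rewrite domE; split=> -[].
have invdom y : chart_cod c y ->
    chart_dom c (chart_inv c y) /\ chart_map c (chart_inv c y) = y.
  by move=> [z zd <-]; rewrite (chart_mapK (mem_set zd)).
have sinv : vsmooth (chart_cod c) (chart_inv c).
  move=> j; apply: smooth_local => x cx.
  have [D [h [oD Dx sh hE]]] := chart_inv_smooth cx.
  have oI : open (chart_cod c `&` D) by apply: openI => //; exact: chart_cod_open.
  exists (chart_cod c `&` D) => //.
  apply: (@smooth_ext _ _ _ (fun y => h y 0 j)) => //; first by move=> y [cy Dy]; rewrite hE.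
  have : vsmooth D h by apply/smooth_open_coords.
  by move=> /(_ j); apply: smooth_sub => y [].
pose W := [set y | chart_cod c y /\ Og (chart_inv c y)].
have c0th : chart_inv c 0 = theta by rewrite -c0 (chart_mapK (mem_set thc)).
have cod0 : chart_cod c 0 by rewrite -c0; exists theta.
exists W, (chart_inv c), (Q `&` Og), g; split; last first.
  by move=> y [cy _]; rewrite fc// qformE addrA.
have gmap y : W y -> g (chart_inv c y) = y.
  by move=> [cy Oy]; have [dy yE] := invdom y cy; rewrite gE.
split => //.
- by apply: open_preimage_vsmooth => //; exact: chart_cod_open.
- by split=> //; rewrite c0th.
- exact: openI.
- by apply: vsmooth_sub sinv => y [].
- have : vsmooth Og g by apply/smooth_open_coords.
  by apply: vsmooth_sub => y [].
- by move=> y [/invdom[/domS[]]].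
- by move=> y [/invdom[/domS[_ Qy] _] Oy].
- move=> z Sz [Qz Oz] [cz _]; have dz : chart_dom c z by apply/domS.
  by rewrite gE// (chart_mapK (mem_set dz)).
Qed.

Lemma qform_is_derive i (j : 'I_n) x :
  is_derive x 'e_j (qform i) (msign R i j * 2 * x 0 j).
Proof.
have -> : qform i = \sum_(k < n) (fun y : 'rV[R]_n => msign R i k * (y 0 k * y 0 k)).
  by apply/funext => y; rewrite fct_sumE; apply: eq_bigr => k _; rewrite expr2.
have dk (k : 'I_n) : is_derive x 'e_j (fun y : 'rV[R]_n => msign R i k * (y 0 k * y 0 k))
    (msign R i k * (2 * (('e_j : 'rV[R]_n) 0 k * x 0 k))).
  have dc : is_derive x 'e_j (fun y : 'rV[R]_n => y 0 k) (('e_j : 'rV[R]_n) 0 k).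
    split; last exact: derive_coord.
    exact/diff_derivable/differentiable_coord.
  have dM := is_deriveM dc dc.
  have -> : (fun y : 'rV[R]_n => msign R i k * (y 0 k * y 0 k)) =
      msign R i k *: ((fun y : 'rV[R]_n => y 0 k) * (fun y : 'rV[R]_n => y 0 k)) by [].
  apply: is_derive_eq; rewrite -![_ *: _]/(_ * _); ring.
apply: is_derive_eq; rewrite (bigD1 j)//= big1 ?addr0.
  by rewrite mxE !eqxx mul1r mulrA.
by move=> k /negPf kj; rewrite mxE kj andbF mul0r !mulr0.
Qed.

Lemma qform_partial i (j : 'I_n) x : 'D_('e_j) (qform i) x = msign R i j * 2 * x 0 j.
Proof. by have [] := qform_is_derive i j x. Qed.

Lemma nondegenerate_of_normal_form f theta i : sphere theta ->
  morse_normal_form f theta i -> nondegenerate_critical_of_index f theta i.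
Proof.
move=> thS [W [P [Q [Phi [[oW W0 oQ P0 sP sPhi PS PO PK KP] fP]]]]].
pose D := S `&` [set z | Q z /\ W (Phi z)].
have codE : Phi @` D = W.
  apply/seteqP; split=> [_ [z [_ [_ Wz]] <-]//|y Wy].
  by exists (P y); rewrite ?PK//; split; [exact: PS | split; [exact: PO | rewrite PK]].
have domO : exists2 V : set 'rV[R]_n.+1, open V & D = S `&` V.
  by exists [set z | Q z /\ W (Phi z)] => //; exact: open_preimage_vsmooth.
have codO : open (Phi @` D) by rewrite codE.
have mapK : {in D, cancel Phi P}.
  by move=> z; rewrite inE => -[Sz [Oz Wz]]; exact: KP.
have maps : smooth_on D Phi.
  move=> z [Sz [Oz Wz]]; exists Q, Phi; split => //.
  by apply/smooth_open_coords.
have invs : smooth_on (Phi @` D) P.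
  rewrite codE => y Wy; exists W, P; split => //.
  by apply/smooth_open_coords.
pose c := SphereChart domO codO mapK maps invs.
have Phi0 : Phi theta = 0 by rewrite -P0 PK.
have Dth : D theta.
  by split=> //; split; [rewrite -P0; exact: PO | rewrite Phi0].
split; last first.
  exists c; split => //; move=> x; rewrite -[chart_cod c]/(Phi @` D) codE => Wx.
  by rewrite /= fP// qformE addrA.
exists c => //=; rewrite Phi0.
have fE x : W x -> \forall y \near x, f (P y) = f theta + qform i y.
  by move=> Wx; exact: (near_open oW Wx).
have Dq (j : 'I_n) x : W x -> 'D_('e_j) (f \o P) x = msign R i j * 2 * x 0 j.
  move=> Wx; rewrite (near_eq_derive _ (fE x Wx)).
  have dq : derivable (qform i) x 'e_j by case: (qform_is_derive i j x).
  by rewrite (@deriveD _ _ _ (cst (f theta)) (qform i))// derive_cst add0r qform_partial.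
split; first by move=> j; rewrite Dq// mxE mulr0.
have -> : hessian (f \o P) 0 = diag_mx (\row_(k < n) (msign R i k * 2)).
  apply/matrixP => j k; rewrite !mxE /=.
  have nE : \forall y \near (0 : 'rV[R]_n), 'D_('e_k) (f \o P) y = msign R i k * 2 * y 0 k.
    by apply: (near_open oW W0) => y; exact: Dq.
  rewrite (near_eq_derive _ nE) deriveMl; last exact/diff_derivable/differentiable_coord.
  rewrite derive_coord mxE eqxx /= [k == j]eq_sym.
  by case: (eqVneq j k) => [->|_]; rewrite ?mulr1 ?mulr1n // mulr0 mulr0n.
rewrite det_diag; apply/prodf_neq0 => k _; rewrite mxE mulf_neq0//.
by rewrite /msign; case: ifP => _; rewrite ?oppr_eq0 oner_eq0.
Qed.

(** Change of coordinates y = a x. The conclusion speaks of pairs (x, y) only, so later computations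
    never meet the local inverse of [a]. *)
Lemma param_reparam theta W P O Phi (Q : set 'rV[R]_n) (a : 'rV[R]_n -> 'rV[R]_n) :
  sphere_param theta W P O Phi -> open Q -> Q 0 -> a 0 = 0 -> vsmooth Q a ->
  Jac a 0 \in unitmx ->
  exists W' P' O' Phi', sphere_param theta W' P' O' Phi' /\
    forall y, W' y -> exists x, [/\ W x, Q x, a x = y & P' y = P x].
Proof.
move=> [oW W0 oO P0 sP sPhi PS PO PK KP] oQ Q0 a0 sa uJ.
have oQW : open (Q `&` W) by exact: openI.
have sa' : vsmooth (Q `&` W) a by apply: vsmooth_sub sa => x [].
have [U [V [b [[oU U0 UQ] [oV V0] sb bP baK]]]] :=
  inverse_function oQW (conj Q0 W0) a0 sa' uJ.
have UW : U `<=` W by move=> x /UQ[].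
pose D := [set z | O z /\ U (Phi z)].
have oD : open D by exact: open_preimage_vsmooth.
exists V, (P \o b), D, (a \o Phi); split; last first.
  move=> y Vy; have [Ub ab] := bP y Vy; have [Qb Wb] := UQ _ Ub.
  by exists (b y).
split => //.
- rewrite /= -P0; congr P; rewrite -[in b 0]a0 baK//= a0//.
- by apply: (vsmooth_comp oV oW _ sb sP) => y /bP[/UW].
- apply: (@vsmooth_comp _ _ _ _ D (Q `&` W)) => //.
  + by move=> z [_ /UQ].
  + by apply: vsmooth_sub sPhi => z [].
- by move=> y /bP[/UW Wb _]; exact: PS.
- by move=> y /bP[Ub _]; split; [exact/PO/UW | rewrite /= PK//; exact: UW].
- by move=> y /bP[Ub ab] /=; rewrite PK ?ab//; exact: UW.
- move=> z Sz [Oz Uz] /= Vz; rewrite baK//; apply: KP => //; exact: UW.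
Qed.

Lemma quadratic_normal_form f theta i W P O Phi (Q : set 'rV[R]_n)
    (E : 'I_n -> 'I_n -> 'rV[R]_n -> R) :
  sphere_param theta W P O Phi -> open Q -> Q 0 ->
  (forall j l, smooth Q (E j l)) ->
  (forall x, Q x -> forall j l, E j l x = E l j x) ->
  signed_form i n (fun j l => E j l 0) ->
  (forall x, W x -> Q x -> f (P x) = f theta + quad (fun j l => E j l x) (x 0)) ->
  morse_normal_form f theta i.
Proof.
move=> pP oQ Q0 sE symE sfE fE.
have [D [L [[oD D0 DQ] sL tL dL qL]]] :=
  smooth_signed_cholesky (leqnn n) oQ Q0 sE symE sfE.
(* These are the linear forms of the factorization at x, evaluated at x itself: in these coordinates
   f is exactly a signed sum of squares. *)
pose a x : 'rV[R]_n := \row_j \sum_l L j l x * x 0 l.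
have sa : vsmooth D a.
  move=> j; apply: (@smooth_ext _ _ _ (fun x => \sum_l L j l x * x 0 l)) => //.
    by move=> x _; rewrite mxE.
  by apply: smooth_sum => // l _; apply: smooth_mul => //; exact: smooth_coord.
have a0 : a 0 = 0.
  by apply/rowP => j; rewrite !mxE big1// => l _; rewrite mxE mulr0.
(* The terms in which L is differentiated carry a factor x l, zero at the origin. The Jacobian is
   the transpose of L(0), hence triangular with nonzero diagonal. *)
have JE k j : Jac a 0 k j = L j k 0.
  rewrite mxE.
  have -> : (fun y => a y 0 j) =
      \sum_(l < n) ((L j l : 'rV[R]_n -> R) * (fun y : 'rV[R]_n => y 0 l)).
    by apply/funext => y; rewrite mxE fct_sumE.
  have dL' l : derivable (L j l) 0 'e_k by exact: diff_derivable (smooth_diff (sL j l) D0).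
  have dc (l : 'I_n) : derivable (fun y : 'rV[R]_n => y 0 l) 0 'e_k.
    exact/diff_derivable/differentiable_coord.
  rewrite derive_sum; last by move=> l; exact: derivableM.
  rewrite (bigD1 k)//= big1 ?addr0.
    by rewrite deriveM// derive_coord !mxE !eqxx scale0r addr0 [_ *: _]mulr1.
  move=> l /negPf lk; rewrite deriveM// derive_coord !mxE lk andbF scale0r addr0.
  exact: mulr0.
have uJ : Jac a 0 \in unitmx.
  rewrite unitmxE -det_tr det_trig.
    rewrite unitfE; apply/prodf_neq0 => j _; rewrite mxE JE; exact: dL.
  by apply/is_trig_mxP => j k jk; rewrite mxE JE tL.
have [W' [P' [D' [Phi' [pP' xP']]]]] := param_reparam pP oD D0 a0 sa uJ.
exists W', P', D', Phi'; split => // y /xP'[x [Wx Dx <- ->]].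
rewrite (fE x Wx (DQ x Dx)) (qL x (x 0) Dx).
  rewrite /qform; congr (_ + _); apply: eq_big => [j|j _]; first by rewrite ltn_ord.
  by rewrite mxE.
by move=> j; rewrite leqNgt ltn_ord.
Qed.

End SphereParam.

(** * Normal forms under the antipodal map and under f -> 1/f *)

Section Symmetries.
Variables (R : realType) (n : nat).
Implicit Types (f g : 'rV[R]_n.+1 -> R) (theta : 'rV[R]_n.+1).

Lemma sphereN theta : sphere theta -> sphere (- theta).
Proof.
rewrite /sphere /= /enorm => <-; congr Num.sqrt.
by apply: eq_bigr => j _; rewrite !mxE mulrNN.
Qed.

Lemma smooth_qform (i : nat) (Q : set 'rV[R]_n) : open Q -> smooth Q (qform i).
Proof.
move=> oQ; apply: smooth_sum => // j _; apply: smooth_mul => //.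
  exact: smooth_cst.
by apply: (@smooth_mul _ _ _ (fun x => x 0 j) (fun x => x 0 j)) => //; exact: smooth_coord.
Qed.

Lemma normal_form_antipodal f g theta i :
  (forall z, sphere z -> g z = f (- z)) ->
  morse_normal_form f theta i -> morse_normal_form g (- theta) i.
Proof.
move=> gf [W [P [Q [Phi [[oW W0 oQ P0 sP sPhi PS PO PK KP] fP]]]]].
have sN : vsmooth [set: 'rV[R]_n.+1] -%R.
  move=> j; apply: (@smooth_ext _ _ _ (fun x : 'rV[R]_n.+1 => - x 0 j)).
  - exact: openT.
  - by move=> x _; rewrite mxE.
  - by apply: smooth_opp; [exact: openT | exact: smooth_coord].
pose Q' := [set z : 'rV[R]_n.+1 | [set: 'rV[R]_n.+1] z /\ Q (- z)].
have oQ' : open Q' by apply: open_preimage_vsmooth => //; exact: openT.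
exists W, (fun y => - P y), Q', (fun z => Phi (- z)); split; last first.
  move=> y Wy; rewrite !gf ?opprK ?fP//; last by apply: sphereN; exact: PS.
  by rewrite -P0; apply: sphereN; exact: PS.
split => //.
- by rewrite P0.
- move=> j; apply: (@smooth_ext _ _ _ (fun y => - P y 0 j)) => //.
    by move=> x _; rewrite mxE.
  exact: smooth_opp.
- apply: (@vsmooth_comp _ _ _ _ Q' Q -%R Phi) => //; first by move=> z [].
  exact: vsmooth_sub sN.
- by move=> y /PS/sphereN.
- by move=> y Wy; split; rewrite ?opprK//; exact: PO.
- by move=> y Wy; rewrite opprK PK.
- by move=> z Sz [_ Qz] Wz; rewrite KP ?opprK//; exact: sphereN.
Qed.

Lemma msign_rev (i : nat) (j : 'I_n) : (i <= n)%N ->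
  msign R (n - i) (rev_ord j) = - msign R i j.
Proof.
move=> le_in; rewrite /msign /=.
have -> : (n - j.+1 < n - i)%N = ~~ (j < i)%N.
  by have := ltn_ord j; lia.
by case: ltnP; rewrite ?opprK.
Qed.

(** With h = f theta, 1/(h + q) = 1/h - q / (h (h + q)). Dividing the coordinates by the square root
    of w = h (h + q) turns the last term into exactly -q, and reversing their order puts the
    negative squares first. *)
Lemma normal_form_inv f g theta i : sphere theta -> (i <= n)%N -> 0 < f theta ->
  (forall z, sphere z -> g z = (f z)^-1) ->
  morse_normal_form f theta i -> morse_normal_form g theta (n - i)%N.
Proof.
move=> Sth le_in f0 gf [W [P [D [Phi [pP fP]]]]].
pose w (x : 'rV[R]_n) := f theta * (f theta + qform i x).
pose Q := [set x : 'rV[R]_n | [set: 'rV[R]_n] x /\ [set t | 0 < t] (w x)].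
have sw V : open V -> smooth V w.
  move=> oV; apply: smooth_mul => //; first exact: smooth_cst.
  by apply: smooth_add => //; [exact: smooth_cst | exact: smooth_qform].
have oQ : open Q by apply: open_preimage_smooth => //; [exact: openT|apply: sw; exact: openT].
have Q0 : Q 0 by split=> //=; rewrite /w qform0 addr0 mulr_gt0.
pose s x := (Num.sqrt (w x))^-1.
have ss : smooth Q s.
  apply: smooth_inv => //; first by move=> x [_ /= wx]; rewrite gt_eqF// sqrtr_gt0.
  by apply: smooth_sqrt => //; [move=> x [] | exact: sw].
pose a x : 'rV[R]_n := \row_j (s x * x 0 (rev_ord j)).
have sa : vsmooth Q a.
  move=> j; apply: (@smooth_ext _ _ _ (fun x => s x * x 0 (rev_ord j))) => //.
    by move=> x _; rewrite mxE.
  by apply: smooth_mul => //; exact: smooth_coord.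
have a0 : a 0 = 0 by apply/rowP => j; rewrite !mxE mulr0.
have s0 : s 0 != 0 by have [_ /= w0] := Q0; rewrite invr_eq0 gt_eqF// sqrtr_gt0.
(* The derivative of s is multiplied by a coordinate, zero at the origin: a permutation matrix
   scaled by s 0 remains. *)
have JE k j : Jac a 0 k j = s 0 * (k == rev_ord j)%:R.
  rewrite mxE.
  have -> : (fun y => a y 0 j) = (s : 'rV[R]_n -> R) * (fun y : 'rV[R]_n => y 0 (rev_ord j)).
    by apply/funext => y; rewrite mxE.
  rewrite deriveM; last 2 first.
  - exact: diff_derivable (smooth_diff ss Q0).
  - exact/diff_derivable/differentiable_coord.
  by rewrite derive_coord !mxE scale0r addr0 eqxx /= eq_sym.
have uJ : Jac a 0 \in unitmx.
  rewrite -row_free_unit; apply: inj_row_free => v /rowP vJ.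
  apply/rowP => k; have := vJ (rev_ord k); rewrite !mxE (bigD1 k)//= big1 ?addr0.
    by rewrite JE rev_ordK eqxx mulr1 => /eqP; rewrite mulf_eq0 (negPf s0) orbF => /eqP.
  by move=> l lk; rewrite JE rev_ordK (negPf lk) !mulr0.
have [W' [P' [D' [Phi' [pP' xP']]]]] := param_reparam pP oQ Q0 a0 sa uJ.
exists W', P', D', Phi'; split => // y /xP'[x [Wx [_ /= wx] <- ->]].
have PS : sphere (P x) := param_sphere pP Wx.
rewrite !gf// fP//.
have -> : qform (n - i)%N (a x) = - (s x ^+ 2 * qform i x).
  rewrite /qform mulr_sumr -sumrN (reindex_inj rev_ord_inj) /=.
  apply: eq_bigr => j _; rewrite msign_rev// mxE rev_ordK exprMn; ring.
have sx : s x ^+ 2 = (w x)^-1 by rewrite /s exprVn sqr_sqrtr// ltW.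
rewrite sx /w; move: wx; rewrite /w pmulr_rgt0// => wx.
by field; rewrite !gt_eqF.
Qed.

End Symmetries.

(** * Polar pairs of functions on the sphere *)

Section EuclideanSpace.
Variables (R : realType) (m : nat).
Implicit Types (x y z : 'rV[R]_m) (c : R).

Lemma dotrC x y : dotr x y = dotr y x.
Proof. by apply: eq_bigr => j _; rewrite mulrC. Qed.

Lemma dotrDl x y z : dotr (x + y) z = dotr x z + dotr y z.
Proof. by rewrite -big_split; apply: eq_bigr => j _; rewrite mxE mulrDl. Qed.

Lemma dotrZl c x z : dotr (c *: x) z = c * dotr x z.
Proof. by rewrite mulr_sumr; apply: eq_bigr => j _; rewrite mxE mulrA. Qed.

Lemma dotrDr x y z : dotr z (x + y) = dotr z x + dotr z y.
Proof. by rewrite dotrC dotrDl ![dotr _ z]dotrC. Qed.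

Lemma dotrZr c x z : dotr z (c *: x) = c * dotr z x.
Proof. by rewrite dotrC dotrZl dotrC. Qed.

Lemma dotrNl x z : dotr (- x) z = - dotr x z.
Proof. by rewrite -scaleN1r dotrZl mulN1r. Qed.

Lemma dotrNr x z : dotr z (- x) = - dotr z x.
Proof. by rewrite dotrC dotrNl dotrC. Qed.

Lemma dotr_suml (I : finType) (F : I -> 'rV[R]_m) z :
  dotr (\sum_i F i) z = \sum_i dotr (F i) z.
Proof.
rewrite /dotr exchange_big; apply: eq_bigr => j _.
by rewrite summxE mulr_suml.
Qed.

Lemma dotr_sumr (I : finType) (F : I -> 'rV[R]_m) z :
  dotr z (\sum_i F i) = \sum_i dotr z (F i).
Proof. by rewrite dotrC dotr_suml; apply: eq_bigr => i _; exact: dotrC. Qed.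

Lemma dotr_ge0 x : 0 <= dotr x x.
Proof. by apply: sumr_ge0 => j _; rewrite -expr2 sqr_ge0. Qed.

Lemma dotr_eq0 x : (dotr x x == 0) = (x == 0).
Proof.
apply/eqP/eqP => [/eqP|->]; last by rewrite /dotr big1// => j _; rewrite mxE mul0r.
rewrite psumr_eq0 => [/allP x0|j _]; last by rewrite -expr2 sqr_ge0.
apply/rowP => j; rewrite mxE; have := x0 j (mem_index_enum j).
by rewrite /= -expr2 sqrf_eq0 => /eqP.
Qed.

Lemma dotr_gt0 x : x != 0 -> 0 < dotr x x.
Proof. by move=> x0; rewrite lt_neqAle dotr_ge0 eq_sym dotr_eq0 x0. Qed.

Lemma enorm_gt0 x : x != 0 -> 0 < enorm x.
Proof. by move=> x0; rewrite sqrtr_gt0 dotr_gt0. Qed.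

Lemma enorm_sq x : enorm x ^+ 2 = dotr x x.
Proof. by rewrite sqr_sqrtr// dotr_ge0. Qed.

Lemma enormZ c x : 0 <= c -> enorm (c *: x) = c * enorm x.
Proof.
move=> c0; rewrite /enorm dotrZl dotrZr mulrA sqrtrM ?mulr_ge0//.
by rewrite -expr2 sqrtr_sqr ger0_norm.
Qed.

Lemma norm_le_enorm x : `|x| <= enorm x.
Proof.
apply: row_norm_le => [|j]; first exact: sqrtr_ge0.
rewrite -sqrtr_sqr ler_sqrt ?sqr_ge0 ?dotr_ge0//.
rewrite /dotr (bigD1 j)//= -expr2 lerDl.
by apply: sumr_ge0 => k _; rewrite -expr2 sqr_ge0.
Qed.

Definition unitv x := (enorm x)^-1 *: x.

Lemma enorm_unitv x : x != 0 -> enorm (unitv x) = 1.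
Proof.
move=> x0; rewrite enormZ ?invr_ge0 ?sqrtr_ge0//.
by rewrite mulVf// gt_eqF// enorm_gt0.
Qed.

Lemma unitvZ c x : 0 < c -> unitv (c *: x) = unitv x.
Proof.
move=> c0; rewrite /unitv enormZ ?ltW// scalerA invfM mulrAC mulVf ?mul1r//.
by rewrite gt_eqF.
Qed.

Lemma unitv_id x : enorm x = 1 -> unitv x = x.
Proof. by move=> x1; rewrite /unitv x1 invr1 scale1r. Qed.

Lemma unitv_scale x : x != 0 -> x = enorm x *: unitv x.
Proof.
by move=> x0; rewrite scalerA divff ?scale1r// gt_eqF// enorm_gt0.
Qed.

Lemma open_neq0 : open [set x : 'rV[R]_m | x != 0].
Proof.
rewrite (_ : [set x | x != 0] = ~` [set (0 : 'rV[R]_m)]).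
  apply: closed_openC; apply: accessible_closed_set1.
  exact: hausdorff_accessible (@norm_hausdorff _ _).
by apply/seteqP; split=> x /= /eqP.
Qed.

End EuclideanSpace.

Section SmoothEuclidean.
Variables (R : realType) (p m : nat).
Implicit Types (O : set 'rV[R]_p) (F G : 'rV[R]_p -> 'rV[R]_m).

Lemma smooth_dotr O F G : open O -> vsmooth O F -> vsmooth O G ->
  smooth O (fun x => dotr (F x) (G x)).
Proof.
move=> oO sF sG; apply: smooth_sum => // j _.
exact: (smooth_mul oO (sF j) (sG j)).
Qed.

Lemma smooth_enorm O F : open O -> vsmooth O F -> (forall x, O x -> F x != 0) ->
  smooth O (fun x => enorm (F x)).
Proof.
move=> oO sF F0; apply: smooth_sqrt => //; last exact: smooth_dotr.
by move=> x /F0/dotr_gt0.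
Qed.

Lemma vsmooth_unitv O F : open O -> vsmooth O F -> (forall x, O x -> F x != 0) ->
  vsmooth O (fun x => unitv (F x)).
Proof.
move=> oO sF F0 j.
apply: (@smooth_ext _ _ _ (fun x => (enorm (F x))^-1 * F x 0 j)) => //.
  by move=> x _; rewrite mxE.
apply: smooth_mul => //; apply: smooth_inv => //; last exact: smooth_enorm.
by move=> x /F0/enorm_gt0/lt0r_neq0.
Qed.

End SmoothEuclidean.

Lemma vsmooth_id (R : realType) (m : nat) (O : set 'rV[R]_m) : vsmooth O id.
Proof. by move=> j; exact: smooth_coord. Qed.

(** * Homogeneous extensions, contact pairs and the Gauss map *)

Section Homogeneous.
Variables (R : realType) (n : nat).
Implicit Types (f : 'rV[R]_n.+1 -> R) (x y z v : 'rV[R]_n.+1).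
Local Notation S := (@sphere R n).

Definition punctured : set 'rV[R]_n.+1 := [set z | z != 0].

Definition hom1 f z := enorm z * f (unitv z).

Definition grad f z : 'rV[R]_n.+1 := \row_j 'D_('e_j) f z.

Lemma sphere_neq0 z : S z -> z != 0.
Proof.
apply: contraPneq => ->; rewrite /sphere /= /enorm.
have /eqP-> : dotr (0 : 'rV[R]_n.+1) 0 == 0 by rewrite dotr_eq0.
by rewrite sqrtr0 => /esym/eqP; rewrite oner_eq0.
Qed.

Lemma sphere_dotr z : S z -> dotr z z = 1.
Proof. by move=> Sz; rewrite -enorm_sq (Sz : enorm z = 1) expr1n. Qed.

Lemma sphere_unitv z : z != 0 -> S (unitv z).
Proof. exact: enorm_unitv. Qed.

Lemma hom1_sphere f z : S z -> hom1 f z = f z.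
Proof. by move=> Sz; rewrite /hom1 unitv_id// (Sz : enorm z = 1) mul1r. Qed.

Lemma smooth_hom1 f : smooth_on S f -> smooth punctured (hom1 f).
Proof.
move=> sf; apply: smooth_local => z z0.
have [D [g [oD Dz sg gE]]] := sf _ (sphere_unitv z0).
have su : vsmooth punctured (@unitv R n.+1).
  by apply: (@vsmooth_unitv _ _ _ _ id) => //; [exact: open_neq0 | exact: vsmooth_id].
pose Q := [set z | punctured z /\ D (unitv z)].
have oQ : open Q by apply: open_preimage_vsmooth => //; exact: open_neq0.
exists Q => //.
apply: (@smooth_ext _ _ _ (fun z => enorm z * g (unitv z))) => //.
  by move=> y [y0 Dy]; rewrite /hom1 gE//; exact: sphere_unitv.
apply: smooth_mul => //.
  by apply: (@smooth_enorm _ _ _ _ id) => //; [exact: vsmooth_id | move=> y []].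
apply: (@smooth_comp _ _ _ _ D (@unitv R n.+1) g) => //; first by move=> y [].
  by apply: vsmooth_sub su => y [].
exact: smooth_open_smooth.
Qed.

Lemma vsmooth_grad (O : set 'rV[R]_n.+1) f : smooth O f -> vsmooth O (grad f).
Proof.
move=> sf j; have := smooth_derive j sf; congr (smooth O _).
by apply/funext => z; rewrite mxE.
Qed.

Lemma derive_grad f z v : differentiable f z -> 'D_v f z = dotr (grad f z) v.
Proof. by move=> df; rewrite derive_partials//; apply: eq_bigr => j _; rewrite mxE. Qed.

Lemma derive_interior_min (O : set 'rV[R]_n.+1) f z v : open O -> O z ->
  (forall y, O y -> differentiable f y) -> (forall y, O y -> f z <= f y) ->
  'D_v f z = 0.
Proof.
move=> oO Oz df fmin.
have lineO : \forall t \near (0 : R), O (z + t *: v).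
  have cl : {for (0 : R), continuous (fun t : R => z + t *: v)}.
    by apply: continuousD; [exact: cst_continuous | exact: scalel_continuous].
  apply: cl; rewrite scale0r addr0; exact: open_nbhs_nbhs.
have [r r0 rO] : exists2 r : R, 0 < r & forall t, `|t| < r -> O (z + t *: v).
  move: lineO => /nbhs_ballP[r r0 rO]; exists r => // t tr; apply: rO.
  by rewrite -ball_normE /= sub0r normrN.
have itv (t : R) : t \in `]-r, r[ -> O (z + t *: v).
  by rewrite in_itv /= => tr; apply: rO; rewrite ltr_norml.
have dl (t : R) : t \in `]-r, r[ -> 
    is_derive t 1 (fun u : R => f (z + u *: v)) ('D_v f (z + t *: v)).
  by move=> /itv Ot; apply: is_derive_line; exact/diff_derivable/df.
have r00 : (0 : R) \in `]-r, r[ by rewrite in_itv /= oppr_lt0 r0.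
have [] := @derive1_at_min R (fun u : R => f (z + u *: v)) (-r) r 0.
- by rewrite -subr_ge0 opprK addr_ge0// ltW.
- by move=> t /dl[].
- exact: r00.
- by move=> t /itv Ot; rewrite scale0r addr0; exact: fmin.
by move=> _; have [_ ->] := dl 0 r00; rewrite scale0r addr0.
Qed.

End Homogeneous.

Section PolarPairs.
Variables (R : realType) (n : nat).
Implicit Types (a b : 'rV[R]_n.+1 -> R) (x y z v : 'rV[R]_n.+1).
Local Notation S := (@sphere R n).

(** Duality expressed on the sphere, without convex bodies and symmetrically in [a] and [b]: what is
    proved about one function holds for the other by [polar_pair_sym]. *)
Record polar_pair a b : Prop := PolarPair {
  polar_posl : forall x, S x -> 0 < a x;
  polar_posr : forall y, S y -> 0 < b y;
  polar_smoothl : smooth_on S a;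
  polar_smoothr : smooth_on S b;
  polar_le : forall x y, S x -> S y -> dotr x y <= a x * b y;
  polar_contactl : forall x, S x -> exists2 y, S y & dotr x y = a x * b y;
  polar_contactr : forall y, S y -> exists2 x, S x & dotr x y = a x * b y
}.

Lemma polar_pair_sym a b : polar_pair a b -> polar_pair b a.
Proof.
move=> [pa pb sa sb le cl cr]; split => // [x y Sx Sy|y Sy|x Sx].
- by rewrite dotrC mulrC; exact: le.
- by have [x Sx xy] := cr y Sy; exists x => //; rewrite dotrC mulrC.
- by have [y Sy xy] := cl x Sx; exists y => //; rewrite dotrC mulrC.
Qed.

Lemma polar_le_hom1 a b x y : polar_pair a b -> x != 0 -> y != 0 ->
  dotr x y <= hom1 a x * hom1 b y.
Proof.
move=> pp x0 y0; rewrite {1}(unitv_scale x0) {1}(unitv_scale y0) dotrZl dotrZr.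
rewrite /hom1 mulrA [leRHS]mulrACA ler_wpM2l ?mulr_ge0 ?sqrtr_ge0//.
by apply: (polar_le pp); exact: sphere_unitv.
Qed.

Lemma is_derive_dotr x v y : is_derive x v (fun z => dotr z y) (dotr v y).
Proof.
have dc (j : 'I_n.+1) : is_derive x v (fun z : 'rV[R]_n.+1 => z 0 j) (v 0 j).
  split; last exact: derive_coord.
  exact/diff_derivable/differentiable_coord.
have -> : (fun z => dotr z y) =
    \sum_(j < n.+1) (y 0 j *: (fun z : 'rV[R]_n.+1 => z 0 j)).
  by apply/funext => z; rewrite fct_sumE; apply: eq_bigr => j _; rewrite mulrC.
by apply: is_derive_eq; apply: eq_bigr => j _; rewrite mulrC.
Qed.

Lemma contact_grad a b x y : polar_pair a b -> S x -> S y ->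
  dotr x y = a x * b y -> b y *: grad (hom1 a) x = y.
Proof.
move=> pp Sx Sy xy; have sH := smooth_hom1 (polar_smoothl pp).
pose f z := b y * hom1 a z - dotr z y.
have oP : open (@punctured R n) by exact: open_neq0.
have dH z : punctured z -> differentiable (hom1 a) z by exact: smooth_diff.
have sf : smooth (@punctured R n) f.
  apply: smooth_add => //; first by apply: smooth_mul => //; exact: smooth_cst.
  apply: smooth_opp => //; apply: smooth_dotr => //; first exact: vsmooth_id.
  by move=> j; exact: smooth_cst.
have f0 v : 'D_v f x = 0.
  apply: (@derive_interior_min _ _ (@punctured R n)) => //.
  - exact: sphere_neq0.
  - by move=> z z0; exact: smooth_diff sf z0.
  move=> z z0; rewrite /f hom1_sphere// xy [b y * a x]mulrC subrr subr_ge0 mulrC.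
  by rewrite -(hom1_sphere b Sy); apply: polar_le_hom1 => //; exact: sphere_neq0.
apply/rowP => j; rewrite !mxE; apply/eqP; rewrite -subr_eq0; apply/eqP.
rewrite -[RHS](f0 'e_j).
have dHx : derivable (hom1 a) x 'e_j by apply/diff_derivable/dH/sphere_neq0.
have [dd dE] := is_derive_dotr x 'e_j y.
have -> : f = (b y *: (hom1 a : 'rV[R]_n.+1 -> R)) - (fun z => dotr z y) by [].
rewrite deriveB//; last exact: derivableZ.
rewrite deriveZ// dE; congr (_ - _).
rewrite /dotr (bigD1 j)//= big1 ?addr0; first by rewrite mxE !eqxx mul1r.
by move=> k /negPf kj; rewrite mxE kj andbF mul0r.
Qed.

Definition gauss a x := unitv (grad (hom1 a) x).

Lemma grad_neq0 a b x : polar_pair a b -> S x -> grad (hom1 a) x != 0.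
Proof.
move=> pp Sx; have [y Sy xy] := polar_contactl pp Sx.
have gE := contact_grad pp Sx Sy xy.
by apply: contraTneq (sphere_neq0 Sy) => g0; rewrite -gE g0 scaler0 negbK eqxx.
Qed.

(** As b y > 0, [contact_grad] forces any contact point y of x to be the normalized gradient, so the
    point given by [polar_contactl] is [gauss a x]; taking norms gives the last equality. *)
Lemma gauss_contact a b x : polar_pair a b -> S x ->
  [/\ S (gauss a x), dotr x (gauss a x) = a x * b (gauss a x) &
      enorm (grad (hom1 a) x) = (b (gauss a x))^-1].
Proof.
move=> pp Sx; have [y Sy xy] := polar_contactl pp Sx.
have gE := contact_grad pp Sx Sy xy; have by0 := polar_posr pp Sy.
have yE : gauss a x = y.
  by rewrite /gauss -(unitvZ _ by0) gE unitv_id.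
rewrite yE; split => //; apply: (mulfI (lt0r_neq0 by0)).
by rewrite -enormZ ?ltW// gE (Sy : enorm y = 1) divff// lt0r_neq0.
Qed.

(** The contact relation is symmetric, and contact points are unique on both sides. *)
Lemma gaussK a b x : polar_pair a b -> S x -> gauss b (gauss a x) = x.
Proof.
move=> pp Sx; have [Sy xy _] := gauss_contact pp Sx.
have yx : dotr (gauss a x) x = b (gauss a x) * a x by rewrite dotrC mulrC.
have := contact_grad (polar_pair_sym pp) Sy Sx yx.
move=> gE; rewrite {1}/gauss -(unitvZ _ (polar_posl pp Sx)) gE.
exact: unitv_id.
Qed.

Lemma open_grad_neq0 a : smooth_on S a ->
  open [set z | punctured z /\ punctured (grad (hom1 a) z)].
Proof.
move=> sa; apply: open_preimage_vsmooth; [exact: open_neq0| |exact: open_neq0].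
exact/vsmooth_grad/smooth_hom1.
Qed.

Lemma vsmooth_gauss a : smooth_on S a ->
  vsmooth [set z | punctured z /\ punctured (grad (hom1 a) z)] (gauss a).
Proof.
move=> sa; apply: vsmooth_unitv; [exact: open_grad_neq0| |by move=> z []].
by apply: vsmooth_sub (vsmooth_grad (smooth_hom1 sa)) => z [].
Qed.

Lemma param_gauss a b theta W P O Phi : polar_pair a b ->
  sphere_param theta W P O Phi ->
  exists O' Phi', sphere_param (gauss a theta) W (gauss a \o P) O' Phi'.
Proof.
move=> pp [oW W0 oO P0 sP sPhi PS PO PK KP].
have pp' := polar_pair_sym pp.
pose Qa := [set z | punctured z /\ punctured (grad (hom1 a) z)].
pose Qb := [set z | punctured z /\ punctured (grad (hom1 b) z)].
have oQa : open Qa by exact/open_grad_neq0/(polar_smoothl pp).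
have oQb : open Qb by exact/open_grad_neq0/(polar_smoothr pp).
have sGa : vsmooth Qa (gauss a) by exact/vsmooth_gauss/(polar_smoothl pp).
have sGb : vsmooth Qb (gauss b) by exact/vsmooth_gauss/(polar_smoothr pp).
have SQa x : S x -> Qa x by move=> Sx; split; [exact: sphere_neq0 | exact: grad_neq0 pp Sx].
have SQb x : S x -> Qb x by move=> Sx; split; [exact: sphere_neq0 | exact: grad_neq0 pp' Sx].
have SG x : S x -> S (gauss a x) by move=> /(gauss_contact pp)[].
have SG' x : S x -> S (gauss b x) by move=> /(gauss_contact pp')[].
pose D := [set z | Qb z /\ O (gauss b z)].
exists D, (Phi \o gauss b); split => //.
- exact: open_preimage_vsmooth.
- by rewrite /= P0.
- by apply: (vsmooth_comp oW oQa _ sP sGa) => y /PS/SQa.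
- apply: (@vsmooth_comp _ _ _ _ D O (gauss b) Phi) => //.
  + exact: open_preimage_vsmooth.
  + by move=> z [].
  + by apply: vsmooth_sub sGb => z [].
- by move=> y /PS/SG.
- move=> y Wy; split; first exact/SQb/SG/PS.
  by rewrite (gaussK pp)//; [exact: PO | exact: PS].
- by move=> y Wy /=; rewrite (gaussK pp) ?PK//; exact: PS.
- move=> z Sz [_ Oz] /= Wz; rewrite KP//; last exact: SG'.
  exact: gaussK pp' Sz.
Qed.

End PolarPairs.

(** * Second-order estimates and the sign of the quadratic form *)

Section SecondOrder.
Variables (R : realType).

(** An unspecified constant C suffices, so the mean value theorem replaces Taylor's formula: the
    directional derivative p is differentiable and zero at x, hence O(u) along the line. *)
Lemma second_order_upper (m : nat) (O : set 'rV[R]_m) (f : 'rV[R]_m -> R) x v :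
  open O -> O x -> smooth O f -> 'D_v f x = 0 ->
  exists2 C : R, 0 < C &
    \forall u \near (0 : R), f (x + u *: v) <= f x + C * u ^+ 2.
Proof.
move=> oO Ox sf f'0.
pose p z := \sum_j 'D_('e_j) f z * v 0 j.
have pE z : O z -> 'D_v f z = p z.
  by move=> Oz; rewrite derive_partials//; exact: smooth_diff sf Oz.
have sp : smooth O p.
  apply: smooth_sum => // j _; apply: smooth_mul => //; last exact: smooth_cst.
  exact: smooth_derive.
have p0 : p x = 0 by rewrite -pE.
have near_x : \forall h \near (0 : 'rV[R]_m), O (h + x) /\
    `|p (h + x) - p x - \sum_j 'D_('e_j) p x * h 0 j| <= 1 * `|h|.
  apply: filterI (differentiableE (smooth_diff sp Ox) ltr01).
  exact/shift_near/open_nbhs_nbhs.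
have [r r0 rP] := near0_ball near_x.
(* The first term comes from the differentiability error of p, taken with e = 1, the second from its
   linear part. *)
pose K := `|v| + `|\sum_j 'D_('e_j) p x * v 0 j|.
have K0 : 0 <= K by rewrite addr_ge0.
have vr0 : 0 < r / (`|v| + 1) by rewrite divr_gt0// ltr_wpDl.
exists (K + 1); first by rewrite ltr_wpDl.
have uv (u t : R) : `|u| <= r / (`|v| + 1) -> 0 <= t <= 1 -> `|(u * t) *: v| <= r.
  move=> ur /andP[t0 t1]; rewrite normrZ normrM (ger0_norm t0).
  apply: (@le_trans _ _ (r / (`|v| + 1) * `|v|)).
    by rewrite ler_wpM2r//; apply: le_trans ur; rewrite ler_piMr.
  rewrite mulrAC ler_pdivrMr ?ltr_wpDl//.
  by apply: ler_wpM2l; [exact: ltW | rewrite lerDl].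
have : \forall u \near (0 : R), `|u| <= r / (`|v| + 1) by exact: nbhs0_le.
apply: filterS => u ur.
have [|t t01] := @segment_MVT _ _ f x v u.
  move=> t t01; have [Oz _] := rP _ (uv u t ur t01).
  by rewrite addrC; exact: diff_derivable (smooth_diff sf Oz).
have [Oz pz] := rP _ (uv u t ur t01).
rewrite -lerBlDl => ->; rewrite [x + _]addrC pE//.
have pu : `|p ((u * t) *: v + x)| <= K * `|u|.
  have -> : p ((u * t) *: v + x) = (p ((u * t) *: v + x) - p x -
      \sum_j 'D_('e_j) p x * ((u * t) *: v) 0 j) + (u * t) * \sum_j 'D_('e_j) p x * v 0 j.
    rewrite p0 subr0 mulr_sumr; have -> : \sum_j u * t * ('D_'e_j p x * v 0 j) =
      \sum_j 'D_'e_j p x * ((u * t) *: v) 0 j.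
      by apply: eq_bigr => j _; rewrite mxE; ring.
    by rewrite subrK.
  have ut : `|u * t| <= `|u|.
    by move: t01 => /andP[t0 t1]; rewrite normrM (ger0_norm t0) ler_piMr.
  rewrite mulrDl; apply: le_trans (ler_normD _ _) _; apply: lerD.
    by apply: le_trans pz _; rewrite mul1r normrZ mulrC ler_wpM2l.
  by rewrite normrM mulrC ler_wpM2l.
apply: le_trans (ler_norm _) _; rewrite normrM.
apply: (@le_trans _ _ (`|u| * (K * `|u|))); first by rewrite ler_wpM2l.
rewrite mulrCA -expr2 real_normK ?num_real//.
by rewrite ler_wpM2r ?sqr_ge0// lerDl.
Qed.

(** Both sides of the inequality equal h0 at order 0, and the conclusion compares their coefficients
    of s^2. *)
Lemma second_order_comparison (n i : nat) (h0 al ga de : R) (X : 'I_n -> R -> R)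
    (w : 'I_n -> R) :
  (forall j, (fun s => s^-1 * X j s) @ 0^' --> w j) ->
  (\forall s \near 0^', h0 * (1 + de * s ^+ 2) <=
    (1 + al * s ^+ 2) * (h0 + \sum_(j < n) msign R i j * X j s ^+ 2) * (1 + ga * s ^+ 2)) ->
  0 <= h0 * (al + ga - de) + \sum_(j < n) msign R i j * w j ^+ 2.
Proof.
move=> Xw le_near.
pose Q s := \sum_(j < n) msign R i j * (s^-1 * X j s) ^+ 2.
set q0 := \sum_(j < n) _.
have Qq : Q @ 0^' --> q0.
  apply: (@cvg_big R _ +%R 0 xpredT (@add_continuous _)) => j _.
  apply: cvgM; first exact: cvg_cst.
  by apply: cvgM; exact: Xw.
(* G is the difference of the two sides divided by s^2, expanded. *)
pose G s := h0 * (al + ga - de) + Q s +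
  s * s * ((al * Q s + al * ga * h0 + ga * Q s) + s * s * (al * ga * Q s)).
have idc : (fun s : R => s) @ 0^' --> (0 : R).
  exact: cvg_within.
have Gl : G @ 0^' --> h0 * (al + ga - de) + q0 +
    0 * 0 * ((al * q0 + al * ga * h0 + ga * q0) + 0 * 0 * (al * ga * q0)).
  apply: cvgD; first by apply: cvgD => //; exact: cvg_cst.
  apply: cvgM; first exact: cvgM.
  apply: cvgD; last by apply: cvgM; [exact: cvgM | apply: cvgM => //; exact: cvg_cst].
  apply: cvgD; last by apply: cvgM => //; exact: cvg_cst.
  by apply: cvgD; [apply: cvgM => //|]; exact: cvg_cst.
rewrite !mul0r addr0 in Gl.
rewrite leNgt; apply/negP => l0.
have Gneg : \forall s \near 0^', G s < 0 by exact: (cvgr_lt _ Gl).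
have Gpos : \forall s \near 0^', 0 <= G s.
  near=> s; have s0 : s != 0 by near: s; exact: nbhs_dnbhs_neq.
  have s2 : 0 < s ^+ 2 by rewrite exprn_even_gt0.
  have : h0 * (1 + de * s ^+ 2) <=
    (1 + al * s ^+ 2) * (h0 + \sum_(j < n) msign R i j * X j s ^+ 2) * (1 + ga * s ^+ 2).
    by near: s.
  have -> : \sum_(j < n) msign R i j * X j s ^+ 2 = s ^+ 2 * Q s.
    by rewrite mulr_sumr; apply: eq_bigr => j _; field.
  rewrite -subr_ge0 (_ : _ - _ = s ^+ 2 * G s); last by rewrite /G; ring.
  by rewrite pmulr_rge0.
have [s [Gn Gp]] := filter_ex (filterI Gneg Gpos).
by move: Gn; rewrite ltNge Gp.
Unshelve. all: by end_near. Qed.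

End SecondOrder.

Section GramForm.
Variables (R : realType) (n p i : nat).

(** The form is D + t D M D with M the Gram matrix of the c j, and its value at v is the sum of the
    d_j v_j^2 plus t |xi|^2, with xi the combination of the c j with coefficients d_j v_j. The
    positive clause is immediate; the hypothesis serves the negative one. *)
Lemma signed_form_gram (c : 'I_n -> 'rV[R]_p) (t : R) : 0 < t ->
  (forall u : 'I_n -> R, let xi := \sum_(j < n) u j *: c j in 0 < dotr xi xi ->
     0 < dotr xi xi + t * \sum_(j < n) msign R i j * dotr (c j) xi ^+ 2) ->
  signed_form i n (fun j k : 'I_n => msign R i j * (j == k)%:R +
     t * (msign R i j * msign R i k * dotr (c j) (c k))).
Proof.
move=> t0 pos; set E := fun j k : 'I_n => _.
pose xi (v : 'I_n -> R) := \sum_(j < n) (msign R i j * v j) *: c j.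
have rowE v (j : 'I_n) :
    \sum_(k < n) E j k * v k = msign R i j * (v j + t * dotr (c j) (xi v)).
  have -> : dotr (c j) (xi v) = \sum_(k < n) msign R i k * v k * dotr (c j) (c k).
    by rewrite dotr_sumr; apply: eq_bigr => k _; rewrite dotrZr.
  rewrite mulrDr !mulr_sumr.
  under eq_bigr do rewrite /E mulrDl; rewrite big_split /=; congr (_ + _).
    rewrite (bigD1 j)//= eqxx mulr1 big1 ?addr0// => k kj.
    by rewrite [j == k]eq_sym (negPf kj) mulr0 mul0r.
  by apply: eq_bigr => k _; ring.
have quadE v : quad E v = \sum_(j < n) msign R i j * v j ^+ 2 + t * dotr (xi v) (xi v).
  rewrite /quad; under eq_bigr do rewrite rowE.
  rewrite {2}/xi dotr_suml mulr_sumr -big_split /=; apply: eq_bigr => j _.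
  by rewrite dotrZl; ring.
split=> v _.
  move=> vi [k vk]; rewrite quadE; apply: ltr_wpDr.
    by rewrite mulr_ge0 ?dotr_ge0// ltW.
  rewrite (bigD1 k)//= ltr_wpDr//.
    apply: sumr_ge0 => j _; rewrite /msign; case: ifP => [ji|_].
      by rewrite vi// expr0n mulr0.
    by rewrite mul1r sqr_ge0.
  rewrite /msign ifF ?mul1r ?exprn_even_gt0//.
  by apply: contraNF vk => ki; rewrite vi.
(* z is the image of v under the form. It is supported on the negative coordinates, so D z = - z and
   v = - z - t w; substituting this in the sum of the v_j z_j gives [qE]. *)
move=> vz [k vk]; pose z (j : 'I_n) := msign R i j * (v j + t * dotr (c j) (xi v)).
have z0 (j : 'I_n) : (i <= j)%N -> z j = 0.
  by move=> ij; have := vz j (ltn_ord j) ij; rewrite rowE.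
pose w j := dotr (c j) (xi v).
have uw : \sum_(j < n) msign R i j * v j * w j = dotr (xi v) (xi v).
  by rewrite [in RHS]/xi dotr_suml; apply: eq_bigr => j _; rewrite dotrZl.
have dz (j : 'I_n) : msign R i j * (z j * z j) = - (z j * z j).
  by rewrite /msign; case: ltnP => ji; rewrite ?mulN1r// z0// !mulr0 oppr0.
have dz' (j : 'I_n) : msign R i j * z j = - z j.
  by rewrite /msign; case: ltnP => ji; rewrite ?mulN1r// z0// mulr0 oppr0.
have qE : quad E v = - \sum_(j < n) z j ^+ 2 -
    t * (dotr (xi v) (xi v) + t * \sum_(j < n) msign R i j * w j ^+ 2).
  rewrite -uw /quad mulrDr !mulr_sumr -big_split /= -sumrN -sumrB.
  apply: eq_bigr => j _; rewrite rowE -/(z j).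
  have zE : z j = msign R i j * (v j + t * w j) by [].
  have vE : v j = - z j - t * w j.
    by rewrite -dz' zE mulrA msign_sq mul1r addrK.
  transitivity (- z j ^+ 2 - t * w j * z j); first by rewrite {1}vE; ring.
  rewrite zE; have := @msign_sq R i j; move: (msign R i j) => d d2.
  have d2' : d ^+ 2 = 1 by rewrite expr2.
  by congr (_ - _); rewrite -[LHS]mul1r; ring.
(* If xi is nonzero the hypothesis makes the second term of [qE] strictly negative; if xi = 0 then z
   = D v is nonzero and the first term is. *)
have [xi0|xi0] := eqVneq (dotr (xi v) (xi v)) 0; last first.
  have xipos : 0 < dotr (xi v) (xi v) by rewrite lt_neqAle eq_sym xi0 dotr_ge0.
  have := pos (fun j => msign R i j * v j) xipos; rewrite -/(xi v) => h.
  rewrite qE -opprD oppr_lt0 ltr_wpDl//; last by rewrite mulr_gt0.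
  by apply: sumr_ge0 => j _; exact: sqr_ge0.
have w0 j : w j = 0.
  move/eqP: xi0; rewrite dotr_eq0 => /eqP xi0.
  by rewrite /w xi0 /dotr big1// => l _; rewrite mxE mulr0.
rewrite qE xi0 [X in t * (0 + t * X)]big1; last by move=> j _; rewrite w0 expr0n mulr0.
rewrite mulr0 addr0 mulr0 subr0.
rewrite oppr_lt0 (bigD1 k)//= ltr_wpDr//; first by apply: sumr_ge0 => j _; exact: sqr_ge0.
rewrite exprn_even_gt0//= /z -/(w k) w0 mulr0 addr0 mulf_neq0//.
by rewrite /msign; case: ifP => _; rewrite ?oppr_eq0 oner_eq0.
Qed.

End GramForm.

(** * Transport of a normal form to the polar function *)

Section PolarNormalForm.
Variables (R : realType) (n : nat) (a b : 'rV[R]_n.+1 -> R) (theta : 'rV[R]_n.+1) (i : nat).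
Variables (W : set 'rV[R]_n) (P : 'rV[R]_n -> 'rV[R]_n.+1).
Variables (O : set 'rV[R]_n.+1) (Phi : 'rV[R]_n.+1 -> 'rV[R]_n).
Local Notation S := (@sphere R n).
Hypothesis ab : polar_pair a b.
Hypothesis pP : sphere_param theta W P O Phi.
Hypothesis aP : forall x, W x -> a (P x) = a theta + qform i x.

Let D := [set z | punctured z /\ [set y | O y /\ W (Phi y)] (unitv z)].
(** The coordinates are extended as functions constant along rays: their gradients are then tangent
    to the sphere, and the radial and tangential parts of grad H are orthogonal. *)
Let X z := Phi (unitv z).
Let gX (j : 'I_n) z := grad (fun y => X y 0 j) z.

Let oP : open (@punctured R n). Proof. exact: open_neq0. Qed.

Let su : vsmooth (@punctured R n) (@unitv R n.+1).
Proof. by apply: (@vsmooth_unitv _ _ _ _ id) => //; exact: vsmooth_id. Qed.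

Let oV : open [set y | O y /\ W (Phi y)].
Proof.
apply: open_preimage_vsmooth; [exact: param_openO pP| |exact: param_openW pP].
exact: param_inv_smooth pP.
Qed.

Let oD : open D.
Proof. by apply: open_preimage_vsmooth. Qed.

Let sX : vsmooth D X.
Proof.
apply: (@vsmooth_comp _ _ _ _ D O (@unitv R n.+1) Phi) => //.
- exact: param_openO pP.
- by move=> z [_ []].
- by apply: vsmooth_sub su => z [].
- exact: param_inv_smooth pP.
Qed.

Let aX z : D z -> a (unitv z) = a theta + qform i (X z).
Proof.
move=> [z0 [Oz Wz]]; have Sz := sphere_unitv z0.
by rewrite -aP// (paramK pP Sz Oz Wz).
Qed.

Let DP x : W x -> D (P x).
Proof.
move=> Wx; have SP := param_sphere pP Wx; split; first exact: sphere_neq0.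
rewrite /= unitv_id//; split; first exact: param_dom pP _ Wx.
by rewrite (param_invK pP).
Qed.

Let XP x : W x -> X (P x) = x.
Proof. by move=> Wx; rewrite /X unitv_id ?(param_invK pP)//; exact: param_sphere pP _ Wx. Qed.

Let gX_radial j z : D z -> dotr z (gX j z) = 0.
Proof.
move=> Dz; have dX : differentiable (fun y => X y 0 j) z by exact: smooth_diff (sX j) Dz.
rewrite dotrC -derive_grad//.
have := @is_derive_line R n.+1 (fun y => X y 0 j) z z 0.
rewrite scale0r addr0 => /(_ (diff_derivable dX)) [_ <-].
have cE : \forall t \near (0 : R), X (z + t *: z) 0 j = X z 0 j.
  have : \forall t \near (0 : R), `|t| < 1 by exact: nbhs0_lt.
  apply: filterS => t; rewrite ltr_norml => /andP[t1 _].
  rewrite -{1}[z]scale1r -scalerDl /X unitvZ//; lra.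
by rewrite (near_eq_derive _ cE) derive_cst.
Qed.

Let derive_enorm (v z : 'rV[R]_n.+1) : S z -> 'D_v (@enorm R n.+1) z = dotr v z.
Proof.
move=> Sz; have z0 := sphere_neq0 Sz.
have se : smooth (@punctured R n) (@enorm R n.+1).
  by apply: (@smooth_enorm _ _ _ _ id) => //; exact: vsmooth_id.
have de : derivable (@enorm R n.+1) z v by exact: diff_derivable (smooth_diff se z0).
have : 'D_v ((@enorm R n.+1) * (@enorm R n.+1)) z = 2 * dotr v z.
  have -> : (@enorm R n.+1 : 'rV[R]_n.+1 -> R) * (@enorm R n.+1) =
      \sum_(j < n.+1) ((fun y : 'rV[R]_n.+1 => y 0 j) * (fun y : 'rV[R]_n.+1 => y 0 j)).
    by apply/funext => y; rewrite fct_sumE -[LHS]expr2 enorm_sq.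
  have dc (j : 'I_n.+1) : is_derive z v (fun y : 'rV[R]_n.+1 => y 0 j) (v 0 j).
    split; last exact: derive_coord.
    exact/diff_derivable/differentiable_coord.
  rewrite derive_sum; last by move=> j; have [d _] := dc j; exact: derivableM.
  rewrite mulr_sumr; apply: eq_bigr => j _; have [d dE] := dc j.
  rewrite deriveM// dE -![_ *: _]/(_ * _); ring.
rewrite deriveM// (Sz : enorm z = 1) !scale1r => h; lra.
Qed.

Let grad_hom1 z : D z -> S z ->
  grad (hom1 a) z = a z *: z + \sum_(j < n) (2 * msign R i j * X z 0 j) *: gX j z.
Proof.
move=> Dz Sz; have z0 := sphere_neq0 Sz.
have az : a z = a theta + qform i (X z) by rewrite -aX// unitv_id.
have sq : smooth setT (@qform R n i) by apply: smooth_qform; exact: openT.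
have nE : \forall y \near z, hom1 a y = enorm y * (a theta + qform i (X y)).
  by apply: (near_open oD Dz) => y Dy; rewrite /hom1 aX.
have dq : differentiable (qform i \o X) z.
  apply: differentiable_comp; first exact: vsmooth_differentiable sX Dz.
  exact: smooth_diff sq _.
have se : smooth (@punctured R n) (@enorm R n.+1).
  by apply: (@smooth_enorm _ _ _ _ id) => //; exact: vsmooth_id.
apply/rowP => l; rewrite !mxE (near_eq_derive _ nE).
have -> : (fun y => enorm y * (a theta + qform i (X y))) =
    (@enorm R n.+1 : 'rV[R]_n.+1 -> R) * (cst (a theta) + (qform i \o X)) by [].
rewrite deriveM; last 2 first.
- exact: diff_derivable (smooth_diff se z0).
- by apply: derivableD => //; exact: diff_derivable.
rewrite deriveD//; last exact: diff_derivable.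
rewrite derive_cst add0r derive_comp; last 2 first.
- exact: vsmooth_differentiable sX Dz.
- exact: smooth_diff sq _.
rewrite (Sz : enorm z = 1) scale1r derive_enorm// [LHS]addrC; congr (_ + _).
  rewrite az; congr (_ * _).
  rewrite /dotr (bigD1 l)//= big1 ?addr0; first by rewrite mxE !eqxx mul1r.
  by move=> k /negPf kl; rewrite mxE kl andbF mul0r.
rewrite summxE; apply: eq_bigr => j _; rewrite qform_partial !mxE.
by rewrite [2 * _]mulrC.
Qed.

Let Stheta : S theta.
Proof. by rewrite -(param0 pP); exact: param_sphere pP _ (param_W0 pP). Qed.

Let Dtheta : D theta.
Proof. by rewrite -(param0 pP); apply: DP; exact: param_W0 pP. Qed.

Let Xtheta : X theta = 0.
Proof. by rewrite -(param0 pP) XP//; exact: param_W0 pP. Qed.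

Let grad_theta : grad (hom1 a) theta = a theta *: theta.
Proof.
rewrite grad_hom1// Xtheta big1 ?addr0// => j _.
by rewrite mxE mulr0 scale0r.
Qed.

Let gauss_theta : gauss a theta = theta.
Proof. by rewrite /gauss grad_theta unitvZ ?unitv_id//; exact: polar_posl ab _ Stheta. Qed.

Let ab_theta : a theta * b theta = 1.
Proof.
have [_ + _] := gauss_contact ab Stheta.
by rewrite gauss_theta sphere_dotr.
Qed.

(* The second-order upper bound for hom1 b along xi, inserted in
   dotr x y <= hom1 a x * hom1 b y at x = theta + s xi and y = theta + s ep xi,
   bounds hom1 a from below; ep minimizes
   C (a theta) ep^2 - ep m. *)
Lemma polar_second_order (u : 'I_n -> R) : let xi := \sum_j u j *: gX j theta in
  0 < dotr xi xi ->
  0 < dotr xi xi + 2 / a theta * \sum_(j < n) msign R i j * dotr (gX j theta) xi ^+ 2.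
Proof.
move=> xi; set m := dotr xi xi => m0.
have h0 := polar_posl ab Stheta; have b0 := polar_posr ab Stheta.
have xith : dotr theta xi = 0.
  by rewrite dotr_sumr big1// => j _; rewrite dotrZr gX_radial// mulr0.
have sHb := smooth_hom1 (polar_smoothr ab).
have th0 := sphere_neq0 Stheta.
have Db0 : 'D_xi (hom1 b) theta = 0.
  rewrite derive_grad; last exact: smooth_diff sHb th0.
  have ba1 : dotr theta theta = b theta * a theta by rewrite mulrC ab_theta sphere_dotr.
  have gE := contact_grad (polar_pair_sym ab) Stheta Stheta ba1.
  apply: (mulfI (lt0r_neq0 h0)); rewrite mulr0 -dotrZl gE.
  exact: xith.
have [C C0 Cb] := second_order_upper oP th0 sHb Db0.
pose ep := m / (2 * C * a theta).
have ep0 : 0 < ep by rewrite divr_gt0 ?mulr_gt0.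
pose ga := C * a theta * ep ^+ 2.
have Xw j : (fun s : R => s^-1 * X (theta + s *: xi) 0 j) @ 0^' --> dotr (gX j theta) xi.
  have dX := smooth_diff (sX j) Dtheta.
  have dv : derivable (fun y => X y 0 j) theta xi by exact: diff_derivable dX.
  have : (fun h : R =>
      h^-1 *: (((fun y => X y 0 j) \o shift theta) (h *: xi) - X theta 0 j)) @ 0^'
      --> 'D_xi (fun y => X y 0 j) theta by exact: dv.
  rewrite derive_grad//; apply: cvg_trans; apply: near_eq_cvg; apply: nearW => s /=.
  by rewrite Xtheta mxE subr0 addrC.
have line v : {for (0 : R), continuous (fun t : R => theta + t *: v)}.
  by apply: continuousD; [exact: cst_continuous | exact: scalel_continuous].
have nD : \forall s \near (0 : R), D (theta + s *: xi).
  by apply: (line xi); rewrite scale0r addr0; exact: open_nbhs_nbhs.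
have nC : \forall s \near (0 : R),
    hom1 b (theta + (s * ep) *: xi) <= hom1 b theta + C * (s * ep) ^+ 2.
  have epc : {for (0 : R), continuous (fun s : R => s * ep)}.
    by apply: continuousM; [exact: cvg_id | exact: cst_continuous].
  have := epc [set u | hom1 b (theta + u *: xi) <= hom1 b theta + C * u ^+ 2].
  by rewrite /= mul0r; apply.
(* The norm of theta + s xi is at most 1 + m s^2 / 2, and the bound on [hom1 b], multiplied by a
   theta = 1 / b theta, gives the factor 1 + ga s^2. *)
have nI : \forall s \near 0^', a theta * (1 + (ep * m) * s ^+ 2) <=
    (1 + (m / 2) * s ^+ 2) *
    (a theta + \sum_(j < n) msign R i j * X (theta + s *: xi) 0 j ^+ 2) *
    (1 + ga * s ^+ 2).
  apply: cvg_within; apply: filterS (filterI nD nC) => s [Ds Cs].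
  have sphi : dotr (theta + s *: xi) (theta + s *: xi) = 1 + s ^+ 2 * m.
    rewrite dotrDl !dotrDr !dotrZl !dotrZr sphere_dotr// xith [dotr xi theta]dotrC xith -/m; ring.
  have xy : dotr (theta + s *: xi) (theta + (s * ep) *: xi) = 1 + ep * m * s ^+ 2.
    rewrite dotrDl !dotrDr !dotrZl !dotrZr sphere_dotr// xith [dotr xi theta]dotrC xith -/m; ring.
  have y0 : theta + (s * ep) *: xi != 0.
    apply: contraTneq (@ltr01 R) => y0.
    have := congr1 (dotr theta) y0; rewrite dotrDr dotrZr xith sphere_dotr// mulr0 addr0.
    have /eqP-> : dotr theta 0 == 0 by rewrite dotrC -(scale0r theta) dotrZl mul0r.
    by move=> ->; rewrite ltxx.
  have x0 := Ds.1.
  have := polar_le_hom1 ab x0 y0; rewrite xy {1}/hom1 aX//.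
  set A := a theta + qform i _ => le1.
  have A0 : 0 < A by rewrite /A -aX//; apply: polar_posl ab _ (sphere_unitv x0).
  have en : enorm (theta + s *: xi) <= 1 + m / 2 * s ^+ 2.
    rewrite -(@ler_pXn2r _ 2)// ?nnegrE ?sqrtr_ge0//; last first.
      by rewrite addr_ge0// mulr_ge0 ?sqr_ge0// divr_ge0 ?ltW.
    rewrite enorm_sq sphi -subr_ge0.
    rewrite (_ : _ - _ = (m / 2 * s ^+ 2) ^+ 2); last by field.
    exact: sqr_ge0.
  have hb : a theta * hom1 b (theta + (s * ep) *: xi) <= 1 + ga * s ^+ 2.
    apply: (le_trans (ler_wpM2l (ltW h0) Cs)).
    rewrite hom1_sphere// mulrDr ab_theta le_eqVlt; apply/orP; left; apply/eqP.
    by rewrite /ga; ring.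
  apply: le_trans (ler_wpM2l (ltW h0) le1) _.
  rewrite mulrCA; apply: ler_pM => //.
  - by rewrite mulr_ge0 ?sqrtr_ge0 ?ltW.
  - rewrite mulr_ge0 ?(ltW h0)// mulr_ge0 ?sqrtr_ge0// ltW//.
    by apply: (polar_posr ab); exact: sphere_unitv.
  - by apply: ler_wpM2r => //; exact: ltW.
have := @second_order_comparison R n i (a theta) (m / 2) ga (ep * m)
  (fun j s => X (theta + s *: xi) 0 j) _ Xw nI.
set T := \sum_(j < n) _ => h.
(* The term - m^2 / (4 C), gained by the choice of ep, makes the conclusion strict; ep = 0 would
   give a weak inequality only. *)
have e1 : a theta * (m / 2 + ga - ep * m) = a theta * (m / 2) - m ^+ 2 / (4 * C).
  by rewrite /ga /ep; field; rewrite !gt_eqF.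
rewrite e1 in h.
have e2 : m + 2 / a theta * T = 2 / a theta * (a theta * (m / 2) + T).
  by field; rewrite gt_eqF.
rewrite e2 mulr_gt0 ?divr_gt0//.
have : 0 < m ^+ 2 / (4 * C) by rewrite divr_gt0 ?exprn_gt0 ?mulr_gt0.
lra.
Qed.

Lemma polar_normal_form_param (g : 'rV[R]_n.+1 -> R) :
  (forall z, S z -> g z = (b z)^-1) -> morse_normal_form g theta i.
Proof.
move=> gb; have h0 := polar_posl ab Stheta.
pose r x := enorm (grad (hom1 a) (P x)).
(* With h = a theta, r - h = (r^2 - h^2) / (h + r) and r^2 - h^2 = (2 h + q) q + 4 x^T D M D x: the
   numerator is a quadratic form in x with smooth coefficients, whereas r itself is a square
   root. *)
pose E (j k : 'I_n) x : R :=
  (msign R i j * (j == k)%:R * (2 * a theta + qform i x) +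
   4 * (msign R i j * msign R i k * dotr (gX j (P x)) (gX k (P x)))) / (a theta + r x).
have oW := param_openW pP; have W0 := param_W0 pP.
have PS x : W x -> S (P x) by exact: param_sphere pP _.
have r_pos x : W x -> 0 < r x.
  by move=> /PS Sx; apply: enorm_gt0; exact: grad_neq0 ab Sx.
have sgH : vsmooth W (grad (hom1 a) \o P).
  apply: (vsmooth_comp oW oP) => [x /PS/sphere_neq0 //||].
    exact: param_smooth pP.
  exact/vsmooth_grad/smooth_hom1/(polar_smoothl ab).
have sr : smooth W r.
  by apply: smooth_enorm => // x Wx; exact: grad_neq0 ab (PS x Wx).
have sgX j : vsmooth W (gX j \o P).
  apply: (vsmooth_comp oW oD) => [x /DP //||]; first exact: param_smooth pP.
  exact: vsmooth_grad (sX j).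
have sE j k : smooth W (E j k).
  have sq := smooth_qform i oW.
  apply: smooth_mul => //; last first.
    apply: smooth_inv => //; last by apply: smooth_add => //; exact: smooth_cst.
    by move=> x /r_pos rx; rewrite gt_eqF// addr_gt0.
  apply: smooth_add => //; apply: smooth_mul => //; [exact: smooth_cst| |exact: smooth_cst|].
    by apply: smooth_add => //; exact: smooth_cst.
  by apply: smooth_mul => //; [exact: smooth_cst | exact: (smooth_dotr oW (sgX j) (sgX k))].
have symE x : W x -> forall j k, E j k x = E k j x.
  move=> _ j k; rewrite /E; congr (_ / _); congr (_ + _).
    by have [->|jk] := eqVneq j k; rewrite ?mulr0.
  by rewrite dotrC [msign R i k * _]mulrC.
have r0 : r 0 = a theta.
  by rewrite /r (param0 pP) grad_theta enormZ ?ltW// (Stheta : enorm theta = 1) mulr1.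
have sfE : signed_form i n (fun j k => E j k 0).
  have t0 : 0 < 2 / a theta by rewrite divr_gt0.
  have := signed_form_gram t0 polar_second_order.
  congr (signed_form i n _); apply/funext => j; apply/funext => k.
  rewrite /E r0 qform0 (param0 pP); field.
  by rewrite !gt_eqF ?addr_gt0.
have [D' [Phi' pG]] := param_gauss ab pP; rewrite gauss_theta in pG.
apply: (quadratic_normal_form pG oW W0 sE symE sfE) => x Wx _ /=.
have Sx := PS x Wx; have [SG _ nG] := gauss_contact ab Sx.
rewrite !gb// -nG -/(r x).
have -> : (b theta)^-1 = a theta.
  by rewrite -[LHS]mul1r -ab_theta mulfK// gt_eqF// (polar_posr ab).
have rx := r_pos x Wx.
have rr : r x ^+ 2 = (a theta + qform i x) ^+ 2 +
    4 * \sum_(j < n) \sum_(k < n) x 0 j * x 0 k *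
      (msign R i j * msign R i k * dotr (gX j (P x)) (gX k (P x))).
  have Dx := DP Wx.
  pose B := \sum_(j < n) (2 * msign R i j * x 0 j) *: gX j (P x).
  have gE : grad (hom1 a) (P x) = (a theta + qform i x) *: P x + B.
    by rewrite grad_hom1// XP// aP.
  rewrite enorm_sq gE.
  have zB : dotr (P x) B = 0.
    by rewrite dotr_sumr big1// => j _; rewrite dotrZr gX_radial// mulr0.
  rewrite dotrDl !dotrDr !dotrZl !dotrZr sphere_dotr// [dotr B (P x)]dotrC zB.
  rewrite !mulr0 addr0 add0r mulr1 -expr2; congr (_ + _).
  rewrite {1}/B dotr_suml mulr_sumr; apply: eq_bigr => j _.
  rewrite dotr_sumr mulr_sumr; apply: eq_bigr => k _.
  by rewrite dotrZl dotrZr; ring.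
have hr : a theta + r x != 0 by rewrite gt_eqF// addr_gt0.
have -> : quad (fun j k => E j k x) (x 0) =
    (r x ^+ 2 - a theta ^+ 2) / (a theta + r x).
  have -> : r x ^+ 2 - a theta ^+ 2 = \sum_(j < n) x 0 j * \sum_(k < n)
     (msign R i j * (j == k)%:R * (2 * a theta + qform i x) +
      4 * (msign R i j * msign R i k * dotr (gX j (P x)) (gX k (P x)))) * x 0 k.
    have -> : r x ^+ 2 - a theta ^+ 2 = (2 * a theta + qform i x) * qform i x +
        (r x ^+ 2 - (a theta + qform i x) ^+ 2) by ring.
    rewrite rr [X in _ + X]addrAC subrr add0r {2}/qform !mulr_sumr -big_split /=.
    apply: eq_bigr => j _; under [in RHS]eq_bigr do rewrite mulrDl.
    rewrite big_split /= mulrDr; congr (_ + _).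
      rewrite (bigD1 j)//= eqxx mulr1n mulr1 big1 ?addr0 => [|k kj]; first by ring.
      by rewrite [j == k]eq_sym (negPf kj) mulr0 !mul0r.
    by rewrite !mulr_sumr; apply: eq_bigr => k _; ring.
  rewrite mulr_suml /quad; apply: eq_bigr => j _.
  rewrite -mulrA mulr_suml; congr (_ * _); apply: eq_bigr => k _.
  by rewrite /E mulrAC.
by field.
Qed.

End PolarNormalForm.

Lemma polar_normal_form (R : realType) (n : nat) (a b g : 'rV[R]_n.+1 -> R) theta i :
  polar_pair a b -> (forall z, sphere z -> g z = (b z)^-1) ->
  morse_normal_form a theta i -> morse_normal_form g theta i.
Proof.
move=> ab gb [W [P [D [Phi [pP aP]]]]].
by apply: (polar_normal_form_param ab pP aP).
Qed.

(** * Wulff shapes *)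

Section EuclideanTopology.
Variables (R : realType) (m : nat).
Implicit Types (x y z : 'rV[R]_m) (A K : set 'rV[R]_m).

Lemma dotr_continuous y : continuous (fun x => dotr x y).
Proof.
move=> x; apply: (@smooth_continuous _ _ [set: 'rV[R]_m]) => //.
apply: smooth_dotr; [exact: openT | exact: vsmooth_id |].
by move=> j; exact: smooth_cst.
Qed.

Lemma dotr_sq_continuous : continuous (fun x => dotr x x).
Proof.
move=> x; apply: (@smooth_continuous _ _ [set: 'rV[R]_m]) => //.
by apply: smooth_dotr; [exact: openT | exact: vsmooth_id | exact: vsmooth_id].
Qed.

Lemma dotr_norm_le x y : `|dotr x y| <= m%:R * (`|x| * `|y|).
Proof.
apply: le_trans (ler_norm_sum _ _ _) _.
apply: (@le_trans _ _ (\sum_(j < m) `|x| * `|y|)); last first.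
  by rewrite sumr_const card_ord -[leLHS]mulr_natl.
by apply: ler_sum => j _; rewrite normrM ler_pM// coord_norm_le.
Qed.

Lemma convex_setP A : @convex_set R 'rV[R]_m A <->
  forall x y (t : R), A x -> A y -> 0 <= t -> t <= 1 -> A (t *: x + (1 - t) *: y).
Proof.
split=> cA x y.
  move=> t Ax Ay t0 t1; have := cA x y (Itv01 t0 t1).
  by rewrite !inE; apply.
move=> l; rewrite !inE => Ax Ay.
by have := cA x y l%:num Ax Ay; apply.
Qed.

Lemma convex_hull_convex A x y (t : R) : convex_hull A x -> convex_hull A y ->
  0 <= t -> t <= 1 -> convex_hull A (t *: x + (1 - t) *: y).
Proof.
move=> Ax Ay t0 t1 M [cM AM].
by have /convex_setP := cM; apply => //; [exact: Ax | exact: Ay].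
Qed.

(** The functional is c = z - k0 with k0 the point of K nearest to z in the Euclidean norm. *)
Lemma convex_separation K z : closed K -> K !=set0 ->
  (forall x y (t : R), K x -> K y -> 0 <= t -> t <= 1 -> K (t *: x + (1 - t) *: y)) ->
  ~ K z -> exists c : 'rV[R]_m, forall k, K k -> dotr c k < dotr c z.
Proof.
move=> clK [p Kp] cK nKz.
pose f k := dotr (k - z) (k - z).
have cf : continuous f.
  move=> x; apply: (@smooth_continuous _ _ [set: 'rV[R]_m]) => //.
  have sz : vsmooth [set: 'rV[R]_m] (fun k => k - z).
    move=> j; apply: (@smooth_ext _ _ _ (fun k : 'rV[R]_m => k 0 j + - z 0 j)).
      exact: openT.
      by move=> k _; rewrite !mxE.
    by apply: smooth_add; [exact: openT | exact: smooth_coord | exact: smooth_cst].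
  by apply: smooth_dotr => //; exact: openT.
(* K need not be bounded; minimizing over the points at least as near as p restores compactness. *)
pose B := K `&` [set k | f k <= f p].
have clB : closed B.
  apply: closedI => //; apply: (@closed_comp _ _ f [set t | t <= f p]).
    by move=> x _; exact: cf.
  exact: closed_le.
have bB k : B k -> `|k| <= `|z| + Num.sqrt (f p).
  move=> [_ kp]; rewrite -[k](subrK z) addrC; apply: le_trans (ler_normD _ _) _.
  rewrite lerD2l; apply: le_trans (norm_le_enorm _) _.
  by rewrite ler_wsqrtr.
have cB : compact B.
  apply: bounded_closed_compact => //.
  exists (`|z| + Num.sqrt (f p)); split; first exact: num_real.
  by move=> M hM k /bB kB; exact: le_trans kB (ltW hM).
have B0 : B !=set0 by exists p; split=> //=.
have [k0] := EVT_min_rV B0 cB (continuous_subspaceT cf).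
rewrite inE => -[Kk0 k0p] kmin.
have fmin k : K k -> f k0 <= f k.
  move=> Kk; have [kp|/ltW pk] := leP (f k) (f p); last exact: le_trans k0p pk.
  by apply: kmin; rewrite inE.
pose c := z - k0.
have c0 : 0 < dotr c c.
  by apply: dotr_gt0; rewrite subr_eq0; apply: contraPneq Kk0 => <-.
exists c => k Kk.
have zE : dotr c z = dotr c k0 + dotr c c by rewrite -dotrDr [k0 + c]addrC subrK.
suff : dotr c (k - k0) <= 0 by rewrite dotrDr dotrNr zE; lra.
rewrite leNgt; apply/negP => pos.
set N := dotr (k - k0) (k - k0); set q := dotr c (k - k0) in pos.
have N0 : 0 <= N by exact: dotr_ge0.
(* Moving from k0 towards k by t changes the squared distance by - 2 t q + t^2 N; since t N <= q
   this is at most - t q < 0. *)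
pose t := q / (q + N).
have qN : 0 < q + N by rewrite ltr_pwDl.
have t0 : 0 < t by rewrite divr_gt0.
have t1 : t <= 1 by rewrite ler_pdivrMr// mul1r lerDl.
have := fmin _ (cK k k0 t Kk Kk0 (ltW t0) t1).
have -> : f (t *: k + (1 - t) *: k0) = f k0 - 2 * t * q + t ^+ 2 * N.
  have e1 : t *: k + (1 - t) *: k0 - z = t *: (k - k0) - c.
    by rewrite scalerBl scale1r scalerBr /c opprB addrA addrCA -addrA addrCA !addrA [k0 + _]addrC.
  have e2 : k0 - z = - c by rewrite /c opprB.
  rewrite /f e1 e2 !dotrDl !dotrDr !dotrNl !dotrNr !dotrZl !dotrZr [dotr (k - k0) c]dotrC -/q -/N.
  by ring.
have tq : t * (q + N) = q by rewrite /t divfK// gt_eqF.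
have tN : t * N <= q by rewrite -tq ler_pM2l// lerDr ltW.
have : t ^+ 2 * N <= t * q by rewrite expr2 -mulrA ler_pM2l.
have : 0 < t * q by rewrite mulr_gt0.
lra.
Qed.

End EuclideanTopology.

(** * From Wulff shapes to polar pairs *)

Section WulffShape.
Variables (R : realType) (n : nat).
Implicit Types (f d : 'rV[R]_n.+1 -> R) (x y z theta : 'rV[R]_n.+1).
Local Notation S := (@sphere R n).

Lemma inv_polar theta (r : R) : S theta -> 0 < r ->
  Defs.inv (polar theta r) = - (r^-1 *: theta).
Proof.
move=> St r0; rewrite /Defs.inv /polar enormZ ?ltW// (St : enorm theta = 1) mulr1.
by rewrite scalerA mulVf ?gt_eqF// scale1r scalerN.
Qed.

Lemma inv_graphP f z : pos_on_sphere f ->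
  (@Defs.inv R n @` graph f) z <-> exists2 theta, S theta & z = - ((f theta)^-1 *: theta).
Proof.
move=> f0; split=> [[_ [t St <-] <-]|[t St ->]].
  by exists t => //; rewrite inv_polar//; exact: f0.
by exists (polar t (f t)); [exists t | rewrite inv_polar//; exact: f0].
Qed.

Lemma sphere_norm_le x : S x -> `|x| <= 1.
Proof. by move=> Sx; rewrite -(Sx : enorm x = 1) norm_le_enorm. Qed.

Lemma sphereP x : S x <-> dotr x x = 1.
Proof.
split; first exact: sphere_dotr.
by move=> xx; rewrite /sphere /= /enorm xx sqrtr1.
Qed.

Lemma sphere_compact : compact S.
Proof.
apply: bounded_closed_compact.
  exists 1; split; first exact: num_real.
  by move=> M M1 x /sphere_norm_le x1; exact: le_trans x1 (ltW M1).
have -> : S = (fun x => dotr x x) @^-1` [set 1].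
  by apply/seteqP; split => x /sphereP.
apply: closed_comp; first by move=> x _; exact: dotr_sq_continuous.
exact: closed_eq.
Qed.

Lemma wulff_shape_closed f : closed (wulff_shape f).
Proof.
apply: closed_bigI => t _.
apply: (@closed_comp _ _ (fun x => dotr x t) [set u | u <= f t]).
  by move=> x _; exact: dotr_continuous.
exact: closed_le.
Qed.

Lemma dotr_sub_le x y z (e : R) : S z -> `|x - y| <= e ->
  `|dotr x z - dotr y z| <= n.+1%:R * e.
Proof.
move=> Sz xye; have -> : dotr x z - dotr y z = dotr (x - y) z by rewrite dotrDl dotrNl.
apply: le_trans (dotr_norm_le _ _) _; apply: ler_wpM2l => //.
by apply: le_trans xye; rewrite ler_piMr// sphere_norm_le.
Qed.

(** By compactness the slack f x - z . x attains its minimum on the sphere; a positive minimum would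
    leave room for a ball around z. *)
Lemma wulff_boundary_contact f z : {within S, continuous f} -> S !=set0 ->
  boundary (wulff_shape f) z -> exists2 x, S x & dotr z x = f x.
Proof.
move=> cf S0 [clz nint].
have Wz : wulff_shape f z by exact: wulff_shape_closed.
have cg : {within S, continuous (fun x => f x - dotr x z)}.
  move=> x; apply: (@continuousB _ _ (subspace S) f (fun x => dotr x z) x); first exact: cf.
  by apply: continuous_subspaceT; exact: dotr_continuous.
have [x Sx xmin] := EVT_min_rV S0 sphere_compact cg.
rewrite inE in Sx; exists x => //.
apply/eqP; rewrite eq_le (Wz x Sx) /= leNgt; apply/negP => lt_zx.
apply: nint.
(* Balls are taken in the sup norm, in which the scalar product with a unit vector is Lipschitz of
   constant n + 1. *)
pose e := (f x - dotr z x) / n.+1%:R.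
have e0 : 0 < e by rewrite divr_gt0// subr_gt0.
apply/nbhs_ballP; exists e => // y; rewrite -ball_normE /= => zy t St.
have := dotr_sub_le St (ltW zy); rewrite mulrCA divff// mulr1 ler_distlC => /andP[_ +].
have := xmin t; rewrite inE => /(_ St); rewrite [dotr x z]dotrC [dotr t z]dotrC /=.
lra.
Qed.

Lemma wulff_shape_bounded f : {within S, continuous f} -> S !=set0 ->
  exists M : R, forall x, wulff_shape f x -> `|x| <= M.
Proof.
move=> cf S0; have [t St tmax] := compact_EVT_max S0 sphere_compact cf.
exists `|f t| => x Wx; apply: row_norm_le => // j.
have ej : S 'e_j.
  apply/sphereP; rewrite /dotr (bigD1 j)//= big1 ?addr0 ?mxE ?eqxx ?mul1r//.
  by move=> k /negPf kj; rewrite mxE kj andbF mul0r.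
have xej : dotr x 'e_j = x 0 j.
  rewrite /dotr (bigD1 j)//= big1 ?addr0 ?mxE ?eqxx ?mulr1//.
  by move=> k /negPf kj; rewrite mxE kj andbF mulr0.
have h1 := Wx _ ej; have h2 := Wx _ (sphereN ej).
have := tmax _ (mem_set ej); have := tmax _ (mem_set (sphereN ej)).
move: h1 h2; rewrite /= dotrNr xej => h1 h2 h3 h4.
have h5 := ler_norm (f t).
by rewrite ler_norml; apply/andP; split; lra.
Qed.

(** A bipolar argument. As - x / f x is a boundary point of the hull, there are points z outside the
    hull as near to it as desired; a hyperplane separating z from the hull has its pole in the Wulff
    shape, and the product of this pole with x is almost f x. Compactness of the Wulff shape makes
    the value f x attained. *)
Lemma wulff_support f x : convex_integrand f -> S x ->
  exists2 z, wulff_shape f z & dotr z x = f x.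
Proof.
move=> [cf f0 bdK] Sx; have S0 : S !=set0 by exists x.
pose C := @Defs.inv R n @` graph f; pose K := convex_hull C.
have {}bdK : boundary K = C := bdK.
have CP z : C z <-> exists2 t, S t & z = - ((f t)^-1 *: t) by exact: inv_graphP.
have CK : C `<=` K by move=> z Cz M [_ CM]; exact: CM.
(* The boundary of the hull is contained in the hull, being equal to the generating set. *)
have clK : closed K.
  move=> z clz; have [|nint] := pselect (interior K z); first exact: interior_subset.
  by apply: CK; rewrite -bdK.
pose p := - ((f x)^-1 *: x).
have fx0 := f0 x Sx.
have Cp : C p by apply/CP; exists x.
have pint : ~ interior K p by have [] : boundary K p by rewrite bdK.
have [M WM] := wulff_shape_bounded cf S0.
have W0 : wulff_shape f 0.
  move=> t St /=; have /eqP-> : dotr 0 t == 0 by rewrite -(scale0r t) dotrZl mul0r.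
  exact/ltW/f0.
have cW : compact (wulff_shape f).
  apply: bounded_closed_compact; last exact: wulff_shape_closed.
  exists M; split; first exact: num_real.
  by move=> L ML z /WM zM; exact: le_trans zM (ltW ML).
have [|z0 Wz0 zmax] := @compact_EVT_max _ R (fun z => dotr z x) _ (ex_intro _ 0 W0) cW.
  by apply: continuous_subspaceT; exact: dotr_continuous.
rewrite inE in Wz0; exists z0 => //.
apply/eqP; rewrite eq_le (Wz0 x Sx) /= leNgt; apply/negP => lt_zx.
have M0 : 0 <= M by apply: le_trans (WM 0 W0); rewrite normr0.
(* Chosen so that the error caused by replacing p by z is at most half of the supposed gap f x - z0
   . x, as [fe] checks. *)
pose e := (f x - dotr z0 x) / (2 * f x * n.+1%:R * (M + 1)).
have M1 : 0 < M + 1 by rewrite ltr_wpDl.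
have e0 : 0 < e by rewrite divr_gt0 ?subr_gt0// !mulr_gt0.
have [z [pz nKz]] : exists z, `|p - z| < e /\ ~ K z.
  apply: contrapT => h; apply: pint; apply/nbhs_ballP; exists e => // z.
  rewrite -ball_normE /= => pz; apply: contrapT => nKz; apply: h.
  by exists z.
have [c cK] := convex_separation clK (ex_intro _ p (CK _ Cp))
  (@convex_hull_convex _ _ C) nKz.
have cE t : S t -> - (dotr c t / f t) < dotr c z.
  move=> St; have : K (- ((f t)^-1 *: t)) by apply: CK; apply/CP; exists t.
  by move/cK; rewrite dotrNr dotrZr mulrC.
have c0 : c != 0.
  apply/eqP => c0; have := cK p (CK _ Cp).
  have d0 y : dotr c y = 0 by rewrite c0 -(scale0r y) dotrZl mul0r.
  by rewrite !d0 ltxx.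
(* The hull contains a positive multiple of c, namely the point of the inverted graph in the
   direction of c, and c . z exceeds the value of c there. *)
have cz0 : 0 < dotr c z.
  have Sc : S (- unitv c) by apply: sphereN; exact: sphere_unitv.
  apply: le_lt_trans (cE _ Sc); rewrite dotrNr mulNr opprK /unitv dotrZr.
  rewrite mulr_ge0 ?mulr_ge0 ?invr_ge0 ?dotr_ge0 ?sqrtr_ge0//.
  exact/ltW/f0.
(* X is the pole of the separating hyperplane. *)
pose X := - ((dotr c z)^-1 *: c).
have WX : wulff_shape f X.
  move=> t St /=; rewrite dotrNl dotrZl.
  have := cE t St; have ft := f0 t St.
  rewrite ltrNl ltr_pdivlMr// mulNr => h.
  have -> : - ((dotr c z)^-1 * dotr c t) = - (dotr c t) / dotr c z by rewrite mulrC mulNr.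
  by rewrite ler_pdivrMr// lerNl [f t * _]mulrC ltW.
have Xz : dotr X z = - 1 by rewrite dotrNl dotrZl mulVf// gt_eqF.
have xE : x = - (f x *: p) by rewrite /p scalerN opprK scalerA divff ?scale1r// gt_eqF.
have dXp : `|dotr X (p - z)| <= n.+1%:R * ((M + 1) * e).
  apply: le_trans (dotr_norm_le _ _) _; apply: ler_wpM2l => //.
  apply: ler_pM => //; last exact: ltW.
  by apply: le_trans (WM X WX) _; rewrite lerDl.
have dXx : dotr X x = f x * (1 - dotr X (p - z)).
  by rewrite {1}xE dotrNr dotrZr dotrDr dotrNr Xz; ring.
have fe : f x * (n.+1%:R * ((M + 1) * e)) = (f x - dotr z0 x) / 2.
  by rewrite /e; field; rewrite !gt_eqF.
have := zmax X (mem_set WX); rewrite dXx => h.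
have := ler_norm (dotr X (p - z)) => h1.
have : f x * dotr X (p - z) <= f x * (n.+1%:R * ((M + 1) * e)).
  by rewrite ler_wpM2l ?(ltW fx0)// (le_trans h1).
rewrite fe => h2.
by move: h; rewrite mulrBr mulr1; lra.
Qed.

Lemma smooth_on_antipodal f : smooth_on S f -> smooth_on S (fun z => f (- z)).
Proof.
move=> sf x Sx; have [Q [g [oQ Qx sg gE]]] := sf _ (sphereN Sx).
have oT := @openT 'rV[R]_n.+1.
have sN : vsmooth [set: 'rV[R]_n.+1] -%R.
  move=> j; apply: (@smooth_ext _ _ _ (fun x : 'rV[R]_n.+1 => - x 0 j)) => //.
    by move=> y _; rewrite mxE.
  by apply: smooth_opp => //; exact: smooth_coord.
pose Q' := [set z : 'rV[R]_n.+1 | [set: 'rV[R]_n.+1] z /\ Q (- z)].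
have oQ' : open Q' by exact: open_preimage_vsmooth.
exists Q', (g \o -%R); split => //.
- apply: smooth_smooth_open; apply: (@smooth_comp _ _ _ Q' Q) => //.
  + by move=> z [].
  + exact: vsmooth_sub sN.
  + exact: smooth_open_smooth.
- by move=> y Sy [_ Qy]; rewrite /= gE//; exact: sphereN.
Qed.

(** The inversion reverses directions: the boundary of the Wulff shape consists of the points y / d
    (- y), hence the sign in the second function. One contact condition comes from [wulff_support],
    the other from [wulff_boundary_contact]. *)
Lemma dual_polar_pair f d : S !=set0 -> convex_integrand f -> Coo_pos f ->
  dual_convex_integrand f d -> Coo_pos d -> polar_pair f (fun z => d (- z)).
Proof.
move=> S0 cf [sf f0] [_ bdE] [sd d0]; have [ctf _ _] := cf.
pose b z := d (- z).
have b0 z : S z -> 0 < b z by move=> Sz; exact/d0/sphereN.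
have bdP z : boundary (wulff_shape f) z <-> exists2 y, S y & z = (b y)^-1 *: y.
  rewrite -bdE inv_graphP//; split=> [[t St ->]|[y Sy ->]].
    by exists (- t); [exact: sphereN | rewrite /b opprK scalerN].
  by exists (- y); [exact: sphereN | rewrite scalerN opprK].
split => //.
- exact: smooth_on_antipodal.
- move=> x y Sx Sy.
  have [clz _] : boundary (wulff_shape f) ((b y)^-1 *: y) by apply/bdP; exists y.
  have Wz := wulff_shape_closed clz.
  have := Wz x Sx; rewrite /= dotrZl dotrC mulrC ler_pdivrMr//; exact: b0.
- move=> x Sx; have [z Wz zx] := wulff_support cf Sx.
  have [|y Sy zE] := (bdP z).1.
    split; first exact: subset_closure.
    move=> intz; have [e e0 ez] : exists2 e : R,
        0 < e & forall y, ball z e y -> wulff_shape f y.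
      by move: intz => /nbhs_ballP[e e0 ez]; exists e.
    (* A point where the constraint of x is an equality cannot be interior: moving it along x
       violates this constraint. *)
    have : wulff_shape f (z + (e / 2) *: x).
      apply: ez; rewrite -ball_normE /= opprD addrA subrr add0r normrN normrZ.
      rewrite gtr0_norm ?divr_gt0//; apply: (@le_lt_trans _ _ (e / 2)).
        by rewrite ler_piMr ?sphere_norm_le// ltW// divr_gt0.
      by rewrite ltr_pdivrMr// ltr_pMr// ltr1n.
    move=> /(_ x Sx); rewrite /= dotrDl dotrZl zx sphere_dotr// mulr1.
    by rewrite gerDl leNgt divr_gt0.
  exists y => //; have by0 := b0 y Sy.
  move: zx; rewrite zE dotrZl dotrC => <-; rewrite mulrC mulrA divff ?mul1r// gt_eqF//.
- move=> y Sy; have [x Sx zx] :=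
    wulff_boundary_contact ctf S0 ((bdP _).2 (ex_intro2 _ _ y Sy erefl)).
  exists x => //; have by0 := b0 y Sy.
  move: zx; rewrite dotrZl dotrC => <-; rewrite mulrC mulrA divff ?mul1r// gt_eqF//.
Qed.

End WulffShape.

(** * The four equivalent conditions *)

Theorem corollary4 (R : realType) (n : nat) (n_gt0 : (0 < n)%N)
    (gamma delta : 'rV[R]_n.+1 -> R)
    (gamma_convex : convex_integrand gamma) (gamma_stable : stable gamma)
    (delta_dual : dual_convex_integrand gamma delta)
    (delta_smooth : Coo_pos delta)
    (theta0 : 'rV[R]_n.+1) (theta0_sphere : sphere theta0)
    (i : nat) (i_le_n : (i <= n)%N) :
  [<-> nondegenerate_critical_of_index gamma theta0 i;
       nondegenerate_critical_of_index delta (- theta0) (n - i)%N;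
       nondegenerate_critical_of_index (hat gamma) (- theta0) (n - i)%N;
       nondegenerate_critical_of_index (hat delta) theta0 i].
Proof.
have [gamma_smooth _] := gamma_stable.
have S0 : (sphere (n := n) (R := R) !=set0)%classic by exists theta0.
have Sth' := sphereN theta0_sphere.
have gd := dual_polar_pair S0 gamma_convex gamma_smooth delta_dual delta_smooth.
set b := (fun z => delta (- z)) in gd.
have sub_le : (n - i <= n)%N by exact: leq_subr.
have subK : (n - (n - i))%N = i by exact: subKn.
have nf (f : 'rV[R]_n.+1 -> R) (th : 'rV[R]_n.+1) k : sphere th ->
    nondegenerate_critical_of_index f th k <-> morse_normal_form f th k.
  move=> Sth; split; last exact: nondegenerate_of_normal_form.
  by case=> _ /morse_index_normal_form.
have dN z : sphere z -> delta z = b (- z) by move=> _; rewrite /b opprK.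
have s14 : morse_normal_form gamma theta0 i -> morse_normal_form (hat delta) theta0 i.
  exact: polar_normal_form gd (fun _ _ => erefl).
have s42 : morse_normal_form (hat delta) theta0 i ->
    morse_normal_form delta (- theta0) (n - i)%N.
  move=> h; apply: (@normal_form_antipodal _ _ b) => //.
  apply: (@normal_form_inv _ _ (hat delta) b theta0 i) => //.
    by rewrite invr_gt0; exact: polar_posr gd _ theta0_sphere.
  by move=> z _; rewrite invrK.
(* This is the implication from (1) to (4) for the exchanged pair (b, gamma), conjugated by the
   antipodal map. *)
have s23 : morse_normal_form delta (- theta0) (n - i)%N ->
    morse_normal_form (hat gamma) (- theta0) (n - i)%N.
  move=> h; apply: (@normal_form_antipodal _ _ (fun z => (gamma z)^-1)) => //.
  apply: (polar_normal_form (polar_pair_sym gd)) => //.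
  by rewrite -[theta0]opprK; apply: normal_form_antipodal h => z _; rewrite /b.
have s31 : morse_normal_form (hat gamma) (- theta0) (n - i)%N ->
    morse_normal_form gamma theta0 i.
  move=> h; rewrite -subK.
  apply: (@normal_form_inv _ _ (fun z => (gamma z)^-1)) => //.
  - by rewrite invr_gt0; exact: polar_posl gd _ theta0_sphere.
  - by move=> z _; rewrite invrK.
  - rewrite -[theta0]opprK; apply: normal_form_antipodal h => z _.
    by rewrite /hat opprK.
(* The cycle proved above is (1), (4), (2), (3), (1); the arrows of the cycle in numerical order are
   composites of its arrows. *)
tfae.
- by move=> /(nf _ _ i theta0_sphere)/s14/s42/(nf _ _ (n - i)%N Sth').
- by move=> /(nf _ _ (n - i)%N Sth')/s23/(nf _ _ (n - i)%N Sth').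
- by move=> /(nf _ _ (n - i)%N Sth')/s31/s14/(nf _ _ i theta0_sphere).
- by move=> /(nf _ _ i theta0_sphere)/s42/s23/s31/(nf _ _ i theta0_sphere).
Qed.
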